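(* There are bipartite network games with general preferences, with arbitrarily large player sets $V$, such that some locally stable matching can be reached by a finite sequence of local improvement steps from the empty matching $M=\emptyset$, but every sequence of local improvement steps from $\emptyset$ ending in a locally stable matching has length $2^{\Omega(|V|)}$.
   Context: A network game consists of a set $V$ of players, a network $N=(V,L)$ whose links are unordered pairs of distinct players, and a set $E$ of potential matching edges. A state is a matching $M\subseteq E$. With general preferences, each player $v$ has a strict preference order over the players $w$ with $\{v,w\}\in E$ and prefers being matched to any of them over being unmatched. The game is bipartite if $V=U\cup W$ (disjoint) and every edge of $E$ joins $U$ and $W$. In state $M$, two players are accessible if their distance in $(V,L\cup M)$ is at most $2$. A local blocking pair of $M$ is a pair $\{u,v\}\in E$ of accessible players each of which is unmatched or strictly prefers the other to its current partner. A locally stable matching is a matching with no local blocking pair. A local improvement step picks a local blocking pair $\{u,v\}$, adds it to $M$ and removes all edges of $M$ incident to $u$ or $v$. *)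

(* Defs.v *)
From mathcomp Require Import all_boot.

Set Implicit Arguments.
Unset Strict Implicit.
Unset Printing Implicit Defensive.

(* Links and edges are unordered pairs of distinct players, i.e. two-element
   sets.  [prefers v w w'] means that v strictly prefers w to w'; it is only
   meaningful, and only constrained, on the players that v can be matched to. *)
Record network_game := NetworkGame {
  player : finType;
  links : {set {set player}};
  edges : {set {set player}};
  prefers : player -> rel player;
  card_link : {in links, forall l : {set player}, #|l| = 2};
  card_edge : {in edges, forall e : {set player}, #|e| = 2};
  prefers_irr : forall v,
    {in [pred w | [set v; w] \in edges], irreflexive (prefers v)};
  prefers_trans : forall v,
    {in [pred w | [set v; w] \in edges] & &, transitive (prefers v)};
  prefers_total : forall v,
    {in [pred w | [set v; w] \in edges] &,
      forall w w', w != w' -> prefers v w w' || prefers v w' w}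
}.

Definition bipartite (G : network_game) : Prop :=
  exists U W : {set player G},
    [/\ U :|: W = [set: player G],
        [disjoint U & W] &
        forall e : {set player G}, e \in edges G ->
          exists u w : player G, [/\ u \in U, w \in W & e = [set u; w]]].

(* Distance at most k in the graph on T with edge set H: a walk u :: p with at
   most k edges ends in v. *)
Definition dist_le (T : finType) (H : {set {set T}}) (k : nat) (u v : T) :
    bool :=
  [exists p : k.-bseq T,
    path [rel x y | [set x; y] \in H] u p && (last u p == v)].

Section Game.
Variable G : network_game.
Implicit Types (M : {set {set player G}}) (u v w : player G).

Definition is_matching M : bool := (M \subset edges G) && trivIset M.

Definition accessible M u v : bool := dist_le (links G :|: M) 2 u v.

Definition unmatched M v : bool := v \notin cover M.

Definition would_accept M v w : bool :=
  unmatched M v || [exists w', ([set v; w'] \in M) && prefers v w w'].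

Definition local_blocking_pair M u v : bool :=
  [&& [set u; v] \in edges G, accessible M u v,
      would_accept M u v & would_accept M v u].

Definition locally_stable M : bool :=
  is_matching M && ~~ [exists u, exists v, local_blocking_pair M u v].

Definition resolve M u v : {set {set player G}} :=
  [set u; v] |: [set e in M | (u \notin e) && (v \notin e)].

Definition improvement_step : rel {set {set player G}} :=
  [rel M M' | [exists u, exists v,
    local_blocking_pair M u v && (M' == resolve M u v)]].

(* [s] lists the states visited after the initial empty matching, so that
   [size s] is the number of steps. *)
Definition improvement_seq (s : seq {set {set player G}}) : bool :=
  path improvement_step set0 s.

Definition final_state (s : seq {set {set player G}}) : {set {set player G}} :=
  last set0 s.

End Game.

(* Main.v *)
(** Levels 1, ..., K each carry a wandering token, a matched pair {cover, partner},
    that runs around a cycle of covers C6 -> C5 -> C4 -> C3 -> C6.  To go once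
    around, it must test four times, alternately, that the token of the level
    below is in its second half {C4, C3} or in its first half {C6, C5}: it slips
    through two consecutive covers of the lower level, both of which have to be
    free.  Hence the token of each level moves half as fast as the one below it.
    All tokens are born from a single source on level 0 and descend: a token of
    level i is created only by consuming that of level i - 1, after the covers
    of level i have been swept against the direction of travel, so that no other
    token is there.  Finally each level has a core which
    stays unstable for ever unless its player Q2 is matched to the cover C3 of
    its level; a stable matching therefore has tokens on all levels, each at the
    end of a full turn counted from the birth of the last one. *)
From HB Require Import structures.
Require Import Defs.
From mathcomp Require Import all_boot all_order all_algebra.
From mathcomp Require Import reals exp zify.

Set Implicit Arguments.
Unset Strict Implicit.
Unset Printing Implicit Defensive.

Lemma set2_inj (T : finType) (a b c d : T) :
  [set a; b] = [set c; d] -> (a = c /\ b = d) \/ (a = d /\ b = c).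
Proof.
move=> /setP E.
move: (E a) (E b) (E c) (E d); rewrite !inE !eqxx ?orbT /=.
move=> /esym/orP[]/eqP-> /esym/orP[]/eqP->; rewrite ?eqxx ?orbT ?orbb => h1 h2;
  by [left | right | left; move/eqP: h2 => -> | right; move/eqP: h1 => ->].
Qed.

(** * Games given by a graph and a ranking *)

Section GraphGame.

Variables (V : finType) (lk ed : rel V) (rk : V -> V -> nat).
Hypothesis lk_sym : symmetric lk.
Hypothesis lk_irr : irreflexive lk.
Hypothesis ed_sym : symmetric ed.
Hypothesis ed_irr : irreflexive ed.
Hypothesis rk_inj : forall v w w', ed v w -> ed v w' -> rk v w = rk v w' -> w = w'.

Definition pairs (r : rel V) : {set {set V}} :=
  [set [set p.1; p.2] | p in [set p : V * V | r p.1 p.2]].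

Lemma in_pairs (r : rel V) x y : symmetric r -> ([set x; y] \in pairs r) = r x y.
Proof.
move=> rs; apply/imsetP/idP => [[[a b]]|rxy]; last by exists (x, y); rewrite // inE.
by rewrite inE /= => rab /set2_inj[][-> ->] //; rewrite rs.
Qed.

Lemma card_pairs (r : rel V) :
  irreflexive r -> {in pairs r, forall e : {set V}, #|e| = 2}.
Proof.
move=> ri e /imsetP[[a b]]; rewrite inE /= => rab ->.
by rewrite cards2; case: eqVneq rab => // ->; rewrite ri.
Qed.

Lemma rk_total v :
  {in [pred w | [set v; w] \in pairs ed] &,
    forall w w', w != w' -> (rk v w < rk v w') || (rk v w' < rk v w)}.
Proof.
move=> w w'; rewrite !inE !in_pairs // => e e' ne; rewrite -neq_ltn.
by apply: contra ne => /eqP/(rk_inj e e')/eqP.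
Qed.

Definition game : network_game :=
  @NetworkGame V (pairs lk) (pairs ed) (fun v w w' => rk v w < rk v w')
    (card_pairs lk_irr) (card_pairs ed_irr)
    (fun v w _ => ltnn (rk v w))
    (fun v _ _ _ _ _ _ => @ltn_trans _ _ _) rk_total.

Implicit Types (M : {set {set V}}) (u v w x : V).

Definition mt M v w := [set v; w] \in M.

Lemma mtC M v w : mt M v w = mt M w v.
Proof. by rewrite /mt setUC. Qed.

Lemma matching_edge M e :
  is_matching (G := game) M -> e \in M -> exists v w, e = [set v; w] /\ ed v w.
Proof.
move=> /andP[/subsetP sub _] /sub /imsetP[[v w]]; rewrite inE /= => vw ->.
by exists v, w.
Qed.

Lemma mt_ed M v w : is_matching (G := game) M -> mt M v w -> ed v w.
Proof. by move=> /andP[/subsetP sub _] /sub; rewrite in_pairs. Qed.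

Lemma mt_uniq M v w w' :
  is_matching (G := game) M -> mt M v w -> mt M v w' -> w = w'.
Proof.
move=> mM h h'; case/andP: (mM) => _ /trivIsetP tr.
have [/set2_inj[][]|ne] := eqVneq [set v; w] [set v; w']; first by [].
  by move=> <- ->.
by have /setDidPl/setP/(_ v) := tr _ _ h h' ne; rewrite !inE eqxx.
Qed.

Definition accepts M v w := forall x, mt M v x -> rk v w < rk v x.

(** The two ways in which [v] is introduced to [u]: by two links, or by its current partner. The
    relation is directed: in the second case [v] is the one who leaves [x]. *)
Definition origin M v u :=
  (exists c, lk v c && lk c u) \/ (exists2 x, mt M v x & lk x u).

Lemma unmatchedP M v :
  is_matching (G := game) M ->
  reflect (forall x, ~ mt M v x) (unmatched (G := game) M v).
Proof.
move=> mM; apply: (iffP negP) => H.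
  by move=> x vx; apply: H; apply/bigcupP; exists [set v; x]; rewrite // !inE eqxx.
move=> /bigcupP[e eM]; case: (matching_edge mM eM) => a [b [eab _]].
by rewrite eab !inE => /orP[]/eqP E; [apply: (H b) | apply: (H a); rewrite mtC];
  rewrite /mt E -eab.
Qed.

Lemma acceptP M v w :
  is_matching (G := game) M ->
  reflect (accepts M v w) (would_accept (G := game) M v w).
Proof.
move=> mM; apply: (iffP orP) => [[/unmatchedP H x|/existsP[y /andP[vy /= lt]] x vx]|H].
- by move/(H mM).
- by rewrite (mt_uniq mM vx vy).
have [x vx|/= none] := pickP (mt M v).
  by right; apply/existsP; exists x; rewrite [_ \in _]vx /=; exact: H.
by left; apply/(unmatchedP _ mM) => x; rewrite none.
Qed.

(** A walk of two matching edges returns to its start, since partners are unique; every other walk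
    of length 2 contains a link at one of its ends. *)
Lemma accessibleP M v u :
  is_matching (G := game) M -> ed v u -> ~~ lk v u ->
  accessible (G := game) M v u ->
  mt M v u \/ origin M v u \/ origin M u v.
Proof.
move=> mM evu nlk /existsP[[[|a [|b [|c q]]] // szp]] /=.
- by move/eqP=> vu; move: evu; rewrite vu ed_irr.
- rewrite andbT !inE in_pairs // => /andP[/orP[vu|vu] /eqP au];
    by [move: nlk; rewrite -au vu | rewrite au in vu; left].
rewrite andbT !inE !in_pairs // => /andP[/andP[/orP[va|va] /orP[ab|ab]] /eqP E];
  rewrite E in ab.
- by right; left; left; exists a; rewrite va ab.
- by right; right; right; exists a; [rewrite mtC | rewrite lk_sym].
- by right; left; right; exists a.
rewrite -[_ \in M]/(mt M v a) mtC in va.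
by move: evu; rewrite (mt_uniq mM va ab) ed_irr.
Qed.

Lemma origin_accessible M v u : origin M v u -> accessible (G := game) M v u.
Proof.
move=> H; have [a [va au]] : exists a, ([set v; a] \in pairs lk :|: M) /\
    ([set a; u] \in pairs lk :|: M).
  case: H => [[a /andP[va au]]|[a va au]]; exists a; rewrite !inE !in_pairs //;
    by rewrite ?va ?au // [_ \in M]va orbT.
by apply/existsP; exists (@Bseq 2 _ [:: a; u] isT); rewrite /= va au eqxx.
Qed.

Lemma blockP M v u :
  is_matching (G := game) M -> (forall v u, ed v u -> ~~ lk v u) ->
  local_blocking_pair (G := game) M v u ->
  [/\ ed v u, accepts M v u, accepts M u v & origin M v u \/ origin M u v].
Proof.
move=> mM nlk /and4P[]; rewrite in_pairs // => e acc /(acceptP _ _ mM) av /(acceptP _ _ mM) au.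
split=> //; have [vu|//] := accessibleP mM e (nlk _ _ e) acc.
by have := av _ vu; rewrite ltnn.
Qed.

Lemma mt_resolve M v u a b :
  mt (resolve (G := game) M v u) a b =
  ([set a; b] == [set v; u]) || [&& mt M a b, v \notin [set a; b] & u \notin [set a; b]].
Proof. by rewrite /mt !inE. Qed.

Lemma resolve_matching M v u :
  is_matching (G := game) M -> ed v u -> is_matching (G := game) (resolve (G := game) M v u).
Proof.
move=> /andP[/subsetP sub /trivIsetP tr] e; apply/andP; split.
  apply/subsetP => f; rewrite !inE => /orP[/eqP->|/andP[/sub]] //.
  by rewrite in_pairs.
apply/trivIsetP => A B; rewrite !inE => /orP[/eqP->|/and3P[AM vA uA]] /orP[/eqP->|/and3P[BM vB uB]];
  first by rewrite eqxx.
- by rewrite disjoints_subset => _; apply/subsetP => x; rewrite !inE => /orP[]/eqP->.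
- by move=> _; rewrite disjoint_sym disjoints_subset; apply/subsetP => x; rewrite !inE => /orP[]/eqP->.
exact: tr.
Qed.

(* By symmetry v may be taken to be the endpoint that was introduced to u. *)
Lemma stepP M M' :
  is_matching (G := game) M -> (forall v u, ed v u -> ~~ lk v u) ->
  improvement_step (G := game) M M' ->
  is_matching (G := game) M' /\
  exists v u, [/\ ed v u, accepts M v u, accepts M u v, origin M v u &
    forall a b, mt M' a b -> [\/ a = v /\ b = u, a = u /\ b = v |
       [/\ mt M a b, a != v, a != u, b != v & b != u]]].
Proof.
move=> mM nlk /existsP[v /existsP[u /andP[bl /eqP->]]].
have [e av au o] := blockP mM nlk bl.
split; first exact: resolve_matching.
have H a b : mt (resolve (G := game) M v u) a b -> [\/ a = v /\ b = u, a = u /\ b = v |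
       [/\ mt M a b, a != v, a != u, b != v & b != u]].
  rewrite mt_resolve => /orP[/eqP/set2_inj[]|]; [by constructor 1|by constructor 2|].
  rewrite !inE !negb_or => /and3P[h /andP[h1 h2] /andP[h3 h4]]; constructor 3.
  by split; rewrite // eq_sym.
case: o => o; first by exists v, u.
exists u, v; split => //; first by rewrite ed_sym.
move=> a b /H[]; [by constructor 2|by constructor 1|].
by case=> *; constructor 3.
Qed.

Lemma path_inv (P : {set {set V}} -> nat -> Prop) :
  P set0 0 ->
  (forall M M' n, P M n -> improvement_step (G := game) M M' -> P M' n.+1) ->
  forall s, improvement_seq (G := game) s -> P (final_state (G := game) s) (size s).
Proof.
move=> P0 PS s; rewrite /improvement_seq /final_state.
elim/last_ind: s => // s M IH; rewrite rcons_path last_rcons size_rcons => /andP[/IH h st].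
exact: PS h st.
Qed.

(** * Reachability and the two elementary steps *)

Definition reach M M' := exists s, path (improvement_step (G := game)) M s /\ last M s = M'.

Lemma reach_refl M : reach M M.
Proof. by exists [::]. Qed.

Lemma reach_trans M1 M2 M3 : reach M1 M2 -> reach M2 M3 -> reach M1 M3.
Proof.
move=> [s [ps <-]] [t [pt <-]]; exists (s ++ t).
by rewrite cat_path last_cat ps pt.
Qed.

Definition idle M v := v \notin cover M.

Lemma idle_set0 v : idle set0 v.
Proof. by rewrite /idle /cover big_set0 inE. Qed.

Lemma idle_add M a b v : idle ([set a; b] |: M) v = [&& v != a, v != b & idle M v].
Proof. by rewrite /idle /cover bigcup_setU big_set1 !inE !negb_or andbA. Qed.

Lemma matching0 : is_matching (G := game) set0.
Proof. by apply/andP; split; [exact: sub0set|apply/trivIsetP => A B; rewrite inE]. Qed.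

Lemma matching_add M a b :
  is_matching (G := game) M -> ed a b -> idle M a -> idle M b ->
  is_matching (G := game) ([set a; b] |: M).
Proof.
move=> mM e fa fb; suff -> : [set a; b] |: M = resolve (G := game) M a b.
  exact: resolve_matching.
apply/setP => f; rewrite !inE; case: eqVneq => //= _.
case fM: (f \in M) => //=; symmetry; apply/andP; split.
  by apply: contra fa => h; apply/bigcupP; exists f.
by apply: contra fb => h; apply/bigcupP; exists f.
Qed.

Lemma idle_not_mt M v x : is_matching (G := game) M -> idle M v -> ~ mt M v x.
Proof. by move=> mM /(unmatchedP _ mM); apply. Qed.

Lemma resolve_add M (f : {set V}) a b :
  idle M a -> idle M b -> (a \in f) || (b \in f) ->
  resolve (G := game) (f |: M) a b = [set a; b] |: M.
Proof.
move=> fa fb abf; apply/setP => g; rewrite !inE; case: eqVneq => //= gab.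
case: (eqVneq g f) => [->|_] /=.
  have -> : (a \notin f) && (b \notin f) = false by rewrite -negb_or abf.
  symmetry; apply/negP => fM; case/orP: abf => h.
    by case/negP: fa; apply/bigcupP; exists f.
  by case/negP: fb; apply/bigcupP; exists f.
case gM: (g \in M) => //=; apply/andP; split.
  by apply: contra fa => h; apply/bigcupP; exists g.
by apply: contra fb => h; apply/bigcupP; exists g.
Qed.

Lemma resolve_idle M a b :
  idle M a -> idle M b -> resolve (G := game) M a b = [set a; b] |: M.
Proof.
move=> fa fb; apply/setP => g; rewrite !inE; case: eqVneq => //= gab.
case gM: (g \in M) => //=; apply/andP; split.
  by apply: contra fa => h; apply/bigcupP; exists g.
by apply: contra fb => h; apply/bigcupP; exists g.
Qed.

(** The moving pair is written on top of a matching in which all three players are idle, so that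
    moves of different tokens can be composed. *)
Lemma step_move M v x u :
  is_matching (G := game) M -> idle M v -> idle M x -> idle M u ->
  ed v x -> ed v u -> lk x u -> rk v u < rk v x ->
  reach ([set v; x] |: M) ([set v; u] |: M).
Proof.
move=> mM fv fx fu evx evu l r.
have mM1 : is_matching (G := game) ([set v; x] |: M) by exact: matching_add.
have vx : mt ([set v; x] |: M) v x by rewrite /mt !inE eqxx.
have ux : u != x by apply: contraTneq r => ->; rewrite ltnn.
have uv : u != v by apply: contraTneq evu => ->; rewrite ed_irr.
have fu1 : idle ([set v; x] |: M) u by rewrite idle_add uv ux.
exists [:: [set v; u] |: M]; split=> //=; rewrite andbT.
apply/existsP; exists v; apply/existsP; exists u; apply/andP; split; last first.
  by rewrite resolve_add // !inE eqxx.
apply/and4P; split; first by rewrite in_pairs.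
- by apply: origin_accessible; right; exists x.
- by apply/(acceptP _ _ mM1) => y vy; rewrite (mt_uniq mM1 vy vx).
by apply/(acceptP _ _ mM1) => y /(idle_not_mt mM1 fu1).
Qed.

Lemma step_static M v u c :
  is_matching (G := game) M -> idle M v -> idle M u ->
  ed v u -> lk v c -> lk c u -> reach M ([set v; u] |: M).
Proof.
move=> mM fv fu e l l'; exists [:: [set v; u] |: M]; split=> //=; rewrite andbT.
apply/existsP; exists v; apply/existsP; exists u; apply/andP; split; last first.
  by rewrite resolve_idle.
apply/and4P; split; first by rewrite in_pairs.
- by apply: origin_accessible; left; exists c; rewrite l l'.
- by apply/(acceptP _ _ mM) => y /(idle_not_mt mM fv).
by apply/(acceptP _ _ mM) => y /(idle_not_mt mM fu).
Qed.

Lemma stable_accepts M v u :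
  locally_stable (G := game) M -> ed v u -> accepts M v u -> accepts M u v ->
  ~ origin M v u.
Proof.
move=> /andP[mM st] e av au o; case/negP: st; apply/existsP; exists v; apply/existsP; exists u.
apply/and4P; split; [by rewrite in_pairs|exact: origin_accessible| |]; exact/acceptP.
Qed.

Lemma stableI M :
  is_matching (G := game) M -> (forall v u, ed v u -> ~~ lk v u) ->
  (forall v u, ed v u -> accepts M v u -> accepts M u v -> origin M v u -> False) ->
  locally_stable (G := game) M.
Proof.
move=> mM nlk H; rewrite /locally_stable mM /=; apply/existsP => -[v /existsP[u bl]].
have [e av au [o|o]] := blockP mM nlk bl; first exact: (H v u).
by apply: (H u v) => //; rewrite ed_sym.
Qed.

End GraphGame.

(** * The players of one level *)

(* C0-C6 are the covers: C6-C3 form the cycle, C2-C0 lead to the level below.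
   Z0-Z3 are the resting partners between covers, Ze the one at birth, Zd the one
   before the descent.  Q0-Q3, Qs, Qu form the core, and Mid is only ever linked. *)
Inductive kind := C0 | C1 | C2 | C3 | C4 | C5 | C6 | Z0 | Z1 | Z2 | Z3 | Ze | Zd
  | Q0 | Q1 | Q2 | Q3 | Qs | Qu | Mid.

Definition kinds : seq kind :=
  [:: C0; C1; C2; C3; C4; C5; C6; Z0; Z1; Z2; Z3; Ze; Zd; Q0; Q1; Q2; Q3; Qs; Qu; Mid].

Definition code (k : kind) : nat :=
  match k with
  | C0 => 0 | C1 => 1 | C2 => 2 | C3 => 3 | C4 => 4 | C5 => 5 | C6 => 6
  | Z0 => 7 | Z1 => 8 | Z2 => 9 | Z3 => 10 | Ze => 11 | Zd => 12
  | Q0 => 13 | Q1 => 14 | Q2 => 15 | Q3 => 16 | Qs => 17 | Qu => 18 | Mid => 19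
  end.

Lemma codeK : cancel code (nth Mid kinds).
Proof. by case. Qed.

HB.instance Definition _ := Countable.copy kind (can_type codeK).

Lemma kinds_enum : Finite.axiom kinds.
Proof. by case. Qed.

HB.instance Definition _ := isFinite.Build kind kinds_enum.

Lemma card_kind : #|{: kind}| = 20.
Proof. by rewrite cardT enumT unlock. Qed.

Lemma mem_kinds k : k \in kinds.
Proof. by case: k. Qed.

(* Preference lists, best first; they also define the edges.  An entry (0, k) is
   the player k of the same level, (1, k) of the level below (one number higher)
   and (2, k) of the level above. *)
Definition pref (k : kind) : seq (nat * kind) :=
  match k with
  | C0 => [:: (1, C6); (1, C5); (1, C4); (2, C1)]
  | C1 => [:: (1, C4); (1, C3); (1, C2); (1, C1); (1, C0); (0, Zd); (2, C1)]
  | C2 => [:: (0, Zd); (0, Z3); (2, C1)]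
  | C3 => [:: (0, Q2); (0, Z3); (1, C4); (1, C3); (0, Z2); (2, C1); (2, C5); (2, C3)]
  | C4 => [:: (0, Z2); (1, C6); (1, C5); (0, Z1); (2, C0); (2, C1); (2, C5); (2, C3)]
  | C5 => [:: (0, Z1); (1, C4); (1, C3); (0, Z0); (2, C0); (2, C6); (2, C4)]
  | C6 => [:: (0, Z0); (1, C6); (1, C5); (0, Ze); (0, Z3); (2, C0); (2, C6); (2, C4)]
  | Z0 => [:: (0, C5); (0, C6)]
  | Z1 => [:: (0, C4); (0, C5)]
  | Z2 => [:: (0, C3); (0, C4)]
  | Z3 => [:: (0, C2); (0, C6); (0, C3)]
  | Ze => [:: (0, C6)]
  | Zd => [:: (0, C1); (0, C2)]
  | Q0 => [:: (0, Q1); (0, Q3); (0, Qu); (0, Qs)]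
  | Q1 => [:: (0, Q2); (0, Q0)]
  | Q2 => [:: (0, C3); (0, Q3); (0, Q1); (0, Qs)]
  | Q3 => [:: (0, Q0); (0, Q2)]
  | Qs => [:: (0, Q0); (0, Q2)]
  | Qu => [:: (0, Q0)]
  | Mid => [::]
  end.

(** * Links and relative levels *)

Definition level_links : seq (kind * kind) :=
  [:: (C6, C5); (C5, C4); (C4, C3); (C3, C2); (C2, C1); (C1, C0); (C3, C6);
      (Z3, Ze); (Z3, Zd); (Z3, Q2); (Q0, Q2); (Q1, Q3); (Qs, Qu); (Qu, Q1)].

(** A pair (a, b) links a of one level to b of the level below. *)
Definition cross_links : seq (kind * kind) :=
  [:: (Ze, C5); (Z0, C6); (Z0, C3); (Z1, C4); (Z1, C5); (Z2, C6); (Z2, C3);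
      (Z3, C4); (Zd, C0); (C0, Ze)].

Definition side (k : kind) : bool :=
  k \in [:: C0; C1; C2; C3; C4; C5; C6; Q1; Q3; Qs; Qu].

Definition off (i j : nat) : nat :=
  if j == i then 0 else if j == i.+1 then 1 else if i == j.+1 then 2 else 3.

(** A representative level at offset [o] from level 1. The offset between two levels near a common
    one depends only on their offsets from it, so [offc] may compute with representatives. *)
Definition lev (o : nat) : nat := nth 9 [:: 1; 2; 0] o.
Definition offc (a b : nat) : nat := off (lev a) (lev b).
Definition offinv (o : nat) : nat := offc o 0.

Lemma off0 i : off i i = 0. Proof. by rewrite /off eqxx. Qed.

Lemma offP i j : 
  [/\ (off i j == 0) = (j == i), (off i j == 1) = (j == i.+1) & (off i j == 2) = (i == j.+1)].
Proof.
rewrite /off; case: (j =P i) => ?; case: (j =P i.+1) => ?; case: (i =P j.+1) => ?;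
  by split => //; lia.
Qed.

Lemma offcE i j k : off i j < 3 -> off i k < 3 -> off j k = offc (off i j) (off i k).
Proof.
rewrite /off; case: (j =P i) => ?; [|case: (j =P i.+1) => ?; [|case: (i =P j.+1) => ?]] => //;
  (case: (k =P i) => ?; [|case: (k =P i.+1) => ?; [|case: (i =P k.+1) => ?]]) => // _ _;
  by rewrite /offc /off /=; case: (k =P j) => ?; case: (k =P j.+1) => ?;
     case: (j =P k.+1) => ? //; lia.
Qed.

(** Two links through [Mid] keep a pair accessible in every state: the source {C1, Zd} on level 0,
    and {Qs, Q2}, which restarts an idle core, on levels 1 to K. *)
Definition mid_link (K l : nat) (k : kind) : bool :=
  if l == 0 then k \in [:: C1; Zd] else (l <= K) && (k \in [:: Qs; Q2]).

Definition link_rel (o : nat) (a b : kind) : bool :=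
  match o with
  | 0 => ((a, b) \in level_links) || ((b, a) \in level_links)
  | 1 => (a, b) \in cross_links
  | 2 => (b, a) \in cross_links
  | _ => false
  end.

(** Contains all actual links but forgets [K] and the level numbers, so that properties of it can be
    decided by enumeration. *)
Definition link_any (o : nat) (a b : kind) : bool :=
  link_rel o a b ||
  (o == 0) && ((a == Mid) && (b \in [:: C1; Zd; Qs; Q2]) ||
               (b == Mid) && (a \in [:: C1; Zd; Qs; Q2])).

Lemma pref_off k p : p \in pref k -> p.1 < 3.
Proof.
move=> h; have : all (fun k => all (fun p => p.1 < 3) (pref k)) kinds by [].
by move/allP/(_ k (mem_kinds k))/allP/(_ _ h).
Qed.

(** * Finite checks of the gadget *)

Definition check1 (P : kind -> nat * kind -> bool) : bool :=
  all (fun k => all (P k) (pref k)) kinds.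

Lemma check1P P : check1 P -> forall k p, p \in pref k -> P k p.
Proof. by move=> h k p hp; move/allP/(_ k (mem_kinds k))/allP/(_ _ hp): h. Qed.

Definition check_static (P : kind -> nat * kind -> kind -> bool) : bool :=
  all (fun k => all (fun p => all (fun c => all (fun o =>
    link_any o k c && link_any (offc o p.1) c p.2 ==> P k p c) [:: 0; 1; 2]) kinds) (pref k)) kinds.

(** Runs through all ways in which [k] may leave [p] for a preferred [q] linked to [p]. *)
Definition check_move (P : kind -> nat * kind -> nat * kind -> bool) : bool :=
  all (fun k => all (fun p => all (fun q =>
    (index q (pref k) < index p (pref k)) && link_any (offc p.1 q.1) p.2 q.2 ==> P k p q)
    (pref k)) (pref k)) kinds.

Definition cov (k : kind) : bool := code k < 7.

Definition weight (k : kind) : nat :=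
  if cov k then 2 else if k \in [:: Q0; Q2] then 1 else 0.

(* Orients every edge: a cover leads its partners of the same level and the covers
   of the level below; an edge belongs to the level of its leader. *)
Definition leads (k : kind) (p : nat * kind) : bool :=
  (p.1 == 1) || (p.1 == 0) && (weight p.2 < weight k).

(* The half of the cycle (false for C6, C5) and the number of tests passed in it. *)
Definition phase (k : kind) (p : nat * kind) : option (bool * nat) :=
  match k, p with
  | C6, (0, Z3) | C6, (0, Ze) | C6, (1, C5) => Some (false, 0)
  | C6, (1, C6) | C6, (0, Z0) => Some (false, 1)
  | C5, (0, Z0) | C5, (1, C3) => Some (false, 1)
  | C5, (1, C4) | C5, (0, Z1) => Some (false, 2)
  | C4, (0, Z1) | C4, (1, C5) => Some (true, 0)
  | C4, (1, C6) | C4, (0, Z2) => Some (true, 1)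
  | C3, (0, Z2) | C3, (1, C3) => Some (true, 1)
  | C3, (1, C4) | C3, (0, Z3) | C3, (0, Q2) => Some (true, 2)
  | _, _ => None
  end.

Definition back (k : kind) (p : nat * kind) : nat * kind := (offinv p.1, k).

Lemma sym_check : check1 (fun k p => back k p \in pref p.2). Proof. by vm_compute. Qed.
Lemma irr_check : check1 (fun k p => p != (0, k)). Proof. by vm_compute. Qed.
Lemma nolink_check : check1 (fun k p => ~~ link_any p.1 k p.2). Proof. by vm_compute. Qed.
Lemma side_check : check1 (fun k p => side k (+) side p.2 (+) (p.1 == 0) == false). Proof. by vm_compute. Qed.
Lemma head_check : check1 (fun k p => ~~ (leads k p && leads p.2 (back k p))). Proof. by vm_compute. Qed.
Lemma phase_check : check1 (fun k p => if phase k p is Some (y, h)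
   then [&& 2 < code k < 7, leads k p, h < 3 & if code k < 5 then y else ~~ y] else true).
Proof. by vm_compute. Qed.
Lemma lower_check : check1 (fun k p => (p.1 == 1) ==> cov k && cov p.2). Proof. by vm_compute. Qed.

Lemma static_check : check_static (fun k p c => (c == Mid) &&
  ((k, p) \in [:: (C1, (0, Zd)); (Zd, (0, C1)); (Qs, (0, Q2)); (Q2, (0, Qs))])).
Proof. by vm_compute. Qed.

Definition creation k p q := [&& k == C6, p == (2, C0) & q == (0, Ze)].

(** Together with [own_tail_check]: apart from a birth, a move leaves a token on its cover or
    carries it to the next cover, one number lower or from C3 to C6. *)
Lemma own_head_check : check_move (fun k p q => cov k && leads k q ==> leads k p || creation k p q).
Proof. by vm_compute. Qed.

Lemma own_tail_check : check_move (fun k p q => cov q.2 && leads q.2 (back k q) ==>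
  [&& leads p.2 (back k p), cov p.2, offc p.1 q.1 == 0 &
      (code p.2 == (code q.2).+1) || (code p.2 == 3) && (code q.2 == 6)]).
Proof. by vm_compute. Qed.

(** Together with [chain_tail_check]: a sweep starts at the lower C0 and visits the lower covers
    upwards one by one, C1 handing over to C0 on the way. *)
Lemma chain_head_check : check_move (fun k p q => (k \in [:: C0; C1]) && (q.1 == 1) ==>
  (q.2 == C0) || (p.1 == 1) && (code q.2 == (code p.2).+1)).
Proof. by vm_compute. Qed.

Lemma chain_tail_check : check_move (fun k p q => (q.2 \in [:: C0; C1]) && (q.1 == 2) ==>
  (p.1 == 2) && (p.2 == C1)).
Proof. by vm_compute. Qed.

(* The covers of the lower level passed, in this order, by the test that raises the count to h. *)
Definition tested (h : nat) : seq nat := if odd h then [:: 5; 6] else [:: 3; 4].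

(** A count grows only by a passage between two consecutive lower covers, which shows that the lower
    token is on neither of them. *)
Lemma phase_head_check : check_move (fun k p q => if phase k q is Some (y', h') then
  creation k p q || if phase k p is Some (y, h) then ((y, h) == (y', h')) ||
    [&& y == y', h' == h.+1, p.1 == 1, q.1 == 1, code p.2 == seq.head 0 (tested h') & code q.2 == last 0 (tested h')] else false
  else true).
Proof. by vm_compute. Qed.

Lemma phase_tail_check : check_move (fun k p q => if phase q.2 (back k q) is Some (y', h') then
  if phase p.2 (back k p) is Some (y, h) then ((y, h) == (y', h')) ||
    [&& y' == ~~ y, h == 2 & h' == 0] else false
  else true).
Proof. by vm_compute. Qed.

(** Whoever moves to Q0 vacates Q2, and Q1 or Q3 moving to Q2 vacates Q0, so such a move never
    serves both at once. *)
Lemma core_check : check_move (fun k p q => (q.1 == 0) ==>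
  [&& (q.2 == Q0) ==> (p == (0, Q2)),
      (q.2 == Q2) && (k \in [:: Q1; Q3]) ==> (p == (0, Q0)) &
      (k == Q2) && (q.2 \in [:: Q1; Q3]) ==> (p.2 \in [:: Q1; Q3])]).
Proof. by vm_compute. Qed.

Lemma core_level_check : check1 (fun k p => (k \in [:: Q0; Q2]) ==> (p.1 == 0)).
Proof. by vm_compute. Qed.

(** * The game with K levels *)

Section Levels.

Variable K : nat.

Notation player := ('I_K.+2 * kind)%type.
Implicit Types (v u w x : player) (M : {set {set player}}).

Definition view v w : nat * kind := (off v.1 w.1, w.2).
Definition edg v w : bool := view v w \in pref v.2.
Definition rnk v w : nat := index (view v w) (pref v.2).
Definition lnk v w : bool :=
  link_rel (off v.1 w.1) v.2 w.2 ||
  (off v.1 w.1 == 0) && ((v.2 == Mid) && mid_link K v.1 w.2 || (w.2 == Mid) && mid_link K v.1 v.2).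

Lemma off_sym i j : off i j = 0 -> off j i = 0.
Proof. by case: (offP i j) (offP j i) => e _ _ [e' _ _] /eqP; rewrite e => /eqP->; rewrite off0. Qed.

Lemma edg_off v w : edg v w -> off v.1 w.1 < 3.
Proof. exact: pref_off. Qed.

Lemma view_back v w : off v.1 w.1 < 3 -> view w v = back v.2 (view v w).
Proof. by move=> h; rewrite /view /back /offinv /= (offcE h (k := v.1)) off0. Qed.

Lemma edg_sym : symmetric edg.
Proof.
move=> v w; apply/idP/idP => e; have := check1P sym_check e;
  by rewrite -view_back // (edg_off e).
Qed.

Lemma edg_irr : irreflexive edg.
Proof.
move=> v; apply/negP => e; have := check1P irr_check e.
by rewrite /view off0 eqxx.
Qed.

Lemma view_inj v w w' : off v.1 w.1 < 3 -> view v w = view v w' -> w = w'.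
Proof.
case: v w w' => i a [j b] [k c]; rewrite /view /= => h [eo ->]; congr (_, _); apply: val_inj => /=.
case: (offP i j) (offP i k) => h0 h1 h2 [g0 g1 g2]; move: h0 h1 h2 g0 g1 g2; rewrite -eo.
by case: (off i j) h => [|[|[|]]] //= _; lia.
Qed.

Lemma rnk_inj v w w' : edg v w -> edg v w' -> rnk v w = rnk v w' -> w = w'.
Proof.
move=> e e' /(congr1 (nth (0, Mid) (pref v.2))).
by rewrite !nth_index // => /(view_inj (edg_off e)).
Qed.

Lemma link_rel_sym i j a b : link_rel (off i j) a b = link_rel (off j i) b a.
Proof.
case: (offP i j) (offP j i) => h0 h1 h2 [g0 g1 g2]; move: h0 h1 h2 g0 g1 g2.
have : off i j < 4 by rewrite /off; do 3 case: ifP => //.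
have : off j i < 4 by rewrite /off; do 3 case: ifP => //.
by case: (off i j) => [|[|[|[|]]]] //=; case: (off j i) => [|[|[|[|]]]] //= *; try lia; rewrite orbC.
Qed.

Lemma lnk_sym : symmetric lnk.
Proof.
move=> v w; rewrite /lnk link_rel_sym; congr (_ || _).
have -> : (off w.1 v.1 == 0) = (off v.1 w.1 == 0) by apply/eqP/eqP; apply: off_sym.
case: eqP => //= /eqP; case: (offP v.1 w.1) => -> _ _ /eqP->; exact: orbC.
Qed.

Lemma lnk_irr : irreflexive lnk.
Proof.
case=> i a; rewrite /lnk /view off0 /= orbb; case: a => //=; rewrite /mid_link;
  by case: eqP => // _; rewrite andbF.
Qed.

Definition clock : network_game :=
  game lnk_irr edg_sym edg_irr rnk_inj.

Lemma lnk_any v w : lnk v w -> link_any (off v.1 w.1) v.2 w.2.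
Proof.
have mid l k : mid_link K l k -> k \in [:: C1; Zd; Qs; Q2].
  by rewrite /mid_link; case: ifP => _; [|move=> /andP[_]]; case: k.
rewrite /lnk /link_any => /orP[->//|/andP[-> /orP[]/andP[-> /mid->]]]; rewrite ?orbT //.
Qed.

Lemma edg_nolink v w : edg v w -> ~~ lnk v w.
Proof. by move=> e; apply: contra (check1P nolink_check e) => /lnk_any. Qed.

Definition moves v x u := [/\ edg v x, edg v u, lnk x u & rnk v u < rnk v x].

Lemma off_view v x u : edg v x -> edg v u -> off x.1 u.1 = offc (view v x).1 (view v u).1.
Proof. by move=> e e'; apply: offcE; [exact: edg_off e|exact: edg_off e']. Qed.

Lemma movesP P v x u : check_move P -> moves v x u -> P v.2 (view v x) (view v u).
Proof.
move=> /allP/(_ _ (mem_kinds v.2)) h [e e' /lnk_any l r].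
move/allP/(_ _ e)/allP/(_ _ e')/implyP: h; apply.
by apply/andP; split=> //; rewrite /= -off_view.
Qed.

Lemma link_any_off o a b : link_any o a b -> o \in [:: 0; 1; 2].
Proof. by case: o => [|[|[|]]]. Qed.

(** Apart from the source and the pairs {Qs, Q2}, every step is therefore a move away from a current
    partner. *)
Lemma staticP v u c : edg v u -> lnk v c -> lnk c u ->
  [\/ [/\ v.2 = C1, u.2 = Zd, v.1 = 0 :> nat & u.1 = 0 :> nat],
      [/\ v.2 = Zd, u.2 = C1, v.1 = 0 :> nat & u.1 = 0 :> nat],
      [/\ v.2 = Qs, u.2 = Q2, u.1 = v.1 & 0 < v.1 <= K] |
      [/\ v.2 = Q2, u.2 = Qs, u.1 = v.1 & 0 < v.1 <= K]].
Proof.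
move=> e l l'; have a := lnk_any l; have a' := lnk_any l'.
have := static_check => /allP/(_ _ (mem_kinds v.2))/allP/(_ _ e)/allP/(_ _ (mem_kinds c.2)).
move=> /allP/(_ _ (link_any_off a))/implyP; rewrite a /=.
rewrite -offcE ?(edg_off e) //; last by have := link_any_off a; rewrite !inE; lia.
rewrite a' => /(_ isT)/andP[/eqP cM].
have nm k k' o : link_rel o k k' -> (k != Mid) && (k' != Mid).
  by case: o => [|[|[|]]] //=; case: k => //; case: k'.
have mid k w : lnk k w -> w.2 = Mid -> mid_link K k.1 k.2.
  rewrite /lnk => /orP[/nm/andP[_ /eqP//]|/andP[_ /orP[]/andP[h1 h2]]] // wM.
  by move: h2; rewrite wM /mid_link; case: ifP => _; rewrite ?andbF.
have m := mid _ _ l cM.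
have ou : off v.1 u.1 = 0 -> u.1 = v.1.
  by move=> h; apply: val_inj; apply/eqP; case: (offP v.1 u.1) => <-; rewrite h.
rewrite !inE => /or4P[]/eqP[vk uo uk]; have uv := ou uo; move: m; rewrite vk /mid_link;
 case: (eqVneq (v.1 : nat) 0) => v0 //=; rewrite ?andbT ?andbF // => vK.
- by constructor 1; rewrite uv.
- by constructor 2; rewrite uv.
- by constructor 3; split=> //; lia.
- by constructor 4; split=> //; lia.
Qed.

(** For a cover [v]: it carries a token of its level, whether its partner is a resting one or a
    cover of the level below. *)
Definition owns M v : Prop := exists2 w, mt M v w & leads v.2 (view v w).

Definition single M : Prop := forall v w, cov v.2 -> cov w.2 -> v.1 = w.1 ->
  0 < v.1 <= K -> owns M v -> owns M w -> v = w.

(* A token of the level above that is sweeping the covers upwards has left no own token behind it. *)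
Definition swept M : Prop := forall c v w, c.2 \in [:: C0; C1] -> (view c v).1 = 1 ->
  mt M c v -> cov w.2 -> w.1 = v.1 -> code w.2 < code v.2 -> ~ owns M w.

(** Excludes states such as {Q0, Q1}, {Q2, Q3}, in which the core could rest without C3. *)
Definition core_single M : Prop := forall (i : 'I_K.+2) a b,
  mt M (i, Q0) a -> mt M (i, Q2) b -> b.2 \in [:: Q1; Q3] -> False.

Record coherent M : Prop := Coherent {
  inv_matching : is_matching (G := clock) M;
  inv_single : single M;
  inv_swept : swept M;
  inv_core : core_single M }.

End Levels.

(** * Preservation of the invariants *)

Section Invariants.

Variable K : nat.

Notation player := ('I_K.+2 * kind)%type.
Implicit Types (v u w x a b : player) (M : {set {set player}}).

(** A step seen from its mover [v]. The pairs of the new state are only bounded from above, as the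
    invariants forbid configurations. *)
Definition transition M M' v u : Prop := [/\ edg v u,
  forall a b, mt M' a b -> [\/ a = v /\ b = u, a = u /\ b = v |
       [/\ mt M a b, a != v, a != u, b != v & b != u]] &
  (exists2 x, mt M v x & moves v x u) \/ (exists2 c, lnk v c & lnk c u)].

Lemma step_transition M M' :
  is_matching (G := clock K) M -> improvement_step (G := clock K) M M' ->
  is_matching (G := clock K) M' /\ exists v u, transition M M' v u.
Proof.
move=> mM st; have [mM' [v [u [e av au o H]]]] := stepP (@lnk_sym K) mM (@edg_nolink K) st.
split=> //; exists v, u; split=> //; case: o => [[c /andP[l l']]|[x vx l]]; [right|left].
  by exists c.
by exists x => //; split=> //; [exact: mt_ed mM vx | exact: av].
Qed.

Lemma eq_player v w : v.1 = w.1 -> code v.2 = code w.2 -> v = w.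
Proof. by case: v w => i a [j b] /= -> /(can_inj codeK)->. Qed.

Lemma off_eq (i j : 'I_K.+2) : off i j == 0 -> i = j.
Proof. by case: (offP i j) => -> _ _ /eqP h; apply: val_inj. Qed.

Lemma lead_cross v w : edg v w -> (view v w).1 = 1 -> cov v.2 /\ cov w.2.
Proof. by move=> e h; move/implyP: (check1P lower_check e); rewrite h => /(_ isT)/andP[]. Qed.

Lemma lead_asym v w : edg v w -> leads v.2 (view v w) -> leads w.2 (view w v) -> False.
Proof.
move=> e h h'; have := check1P head_check e; rewrite h /=.
by rewrite -view_back ?(edg_off e) // h'.
Qed.

Lemma move_back v x u : moves v x u ->
  view x v = back v.2 (view v x) /\ view u v = back v.2 (view v u).
Proof. by case=> e e' _ _; rewrite -!view_back ?(edg_off e) ?(edg_off e'). Qed.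

Variant new_own M v u a : Prop :=
  | OldOwn w of mt M a w & leads a.2 (view a w) & a != v & a != u & w != v & w != u
  | SameCover x of a = v & leads v.2 (view v u) & mt M v x & leads v.2 (view v x)
  | NextCover x of a = u & leads u.2 (view u v) & mt M v x & leads x.2 (view x v) & cov x.2 & x.1 = u.1
      & code x.2 = (code u.2).+1 \/ code x.2 = 3 /\ code u.2 = 6
  | Created x of a = v & leads v.2 (view v u) & v.2 = C6 & x.2 = C0 & (view x v).1 = 1 & mt M v x.

Lemma ownsP M M' v u a : transition M M' v u ->
  cov a.2 -> 0 < a.1 -> owns M' a -> new_own M v u a.
Proof.
move=> [e old orig] ca ia [w /old aw la]; case: aw => [[av wu]|[au wv]|[h1 h2 h3 h4 h5]]; last exact: OldOwn h1 la h2 h3 h4 h5.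
- subst a w; case: orig => [[x vx m]|[c l l']]; last first.
    have [] := staticP e l l' => -[vk _ v0] _; move: la ia ca; rewrite ?v0 ?vk //.
  have := movesP own_head_check m; rewrite ca la /= => /orP[lx|/and3P[/eqP v6 /eqP vx2 _]].
    exact: SameCover la vx lx.
  have [b _] := move_back m.
  by apply: (Created _ la v6 _ _ vx) => //; [case: vx2 | rewrite b vx2].
subst a w; case: orig => [[x vx m]|[c l l']]; last first.
  have [] := staticP e l l' => -[vk uk v0 u0]; move: la ia ca; rewrite ?uk ?u0 //.
have [b b'] := move_back m.
have := movesP own_tail_check m; rewrite -b -b' ca la /=.
case: (m) => e1 e2 _ _; rewrite -off_view // => /and4P[lx cx /off_eq xu h].
apply: (NextCover _ la vx lx cx xu) => //.
by case/orP: h => [/eqP|/andP[/eqP ? /eqP ?]]; [left|right].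
Qed.

Lemma single_old_new M M' v u a b w : coherent M -> transition M M' v u ->
  cov a.2 -> cov b.2 -> a.1 = b.1 -> 0 < a.1 <= K -> owns M' a ->
  mt M b w -> leads b.2 (view b w) -> b != v -> b != u -> w != v -> a = b.
Proof.
move=> [mM sM wM _] t ca cb ab ia oa bw lb bv bu wv.
have ob : owns M b by exists w.
case: (ownsP t ca _ oa); first by case/andP: ia.
- by move=> w' aw la _ _ _ _; apply: sM => //; exists w'.
- move=> x av _ vx lx; subst a; apply: sM => //; by exists x.
- move=> x au _ vx lx cx xu _; subst a.
  have E : x = b.
    by apply: sM; rewrite ?xu //; exists v => //; rewrite mtC.
  by subst b; case/eqP: wv; apply: (mt_uniq mM bw); rewrite mtC.
move=> x av _ v6 x0 xv vx; subst a.
(* At a birth the C0 of the level above held C6, so [swept] leaves no owner on any cover with a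
   smaller number. *)
have [b6|b6] := eqVneq (code b.2) 6.
  by case/eqP: bv; apply: eq_player; rewrite // b6 v6.
case: (@wM x v b _ _ _ _ _ _ ob); rewrite ?x0 ?v6 //; first by rewrite mtC.
by rewrite ltn_neqAle b6.
Qed.

(** If both owners are new, they coincide or are the two ends of the new pair, which cannot lead
    each other. *)
Lemma single_step M M' v u : coherent M -> transition M M' v u -> single M'.
Proof.
move=> iM t a b ca cb ab ia oa ob; have ib : 0 < b.1 <= K by rewrite -ab.
have [e _ _] := t.
have asym := lead_asym e.
case: (ownsP t cb _ ob); first by case/andP: ib.
- by move=> w bw lb bv bu wv _; apply: (single_old_new iM t _ _ _ _ _ bw).
all: case: (ownsP t ca _ oa); first (by case/andP: ia).
all: try by move=> w aw la av au wv _ *; symmetry; apply: (single_old_new iM t _ _ _ _ _ aw).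
all: try by move=> x -> ? ? ? ? ? ?; subst.
all: by move=> *; subst; (reflexivity || (exfalso; apply: asym)).
Qed.

(** Sweep and token travel in opposite directions and cannot pass each other, since each of them
    occupies a cover. *)
Lemma swept_step M M' v u : coherent M -> transition M M' v u -> swept M'.
Proof.
move=> [mM sM wM _] t c q q' cc cq mcq cq' qq' lt oq.
have [e old orig] := t.
have iq : 0 < q.1 by move: cq; rewrite /view /= => /eqP; case: (offP c.1 q.1) => _ -> _ /eqP->.
have iq' : 0 < q'.1 by rewrite qq'.
have oN := ownsP t cq' iq' oq.
case: (old _ _ mcq) => [[cv qu]|[cu qv]|[Mcq cv cu qv qu]].
(* The sweep advances: an owner behind its new place but not behind the old one would sit on the
   cover just left, which the sweep was holding. *)
- subst c q.
  have nold : ~ (exists w, [/\ mt M q' w, leads q'.2 (view q' w), q' != u & w != v]).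
    move=> [w [q'w lq' q'u wv]].
    case: orig => [[x vx m]|[c l l']]; last first.
      by have [] := staticP e l l' => -[vk uk v0 u0]; move: cc iq; rewrite ?vk ?u0.
    have := movesP chain_head_check m; rewrite cc cq /= => /orP[/eqP u0|/andP[/eqP vx1 /eqP ux]].
      by move: lt; rewrite u0.
    have xu : x.1 = u.1.
      by apply: off_eq; case: m => e1 e2 _ _; rewrite (off_view e1 e2) -[(view v x).1]/(off v.1 x.1) vx1 cq.
    have [q'x|q'x] := eqVneq (code q'.2) (code x.2).
      have E : q' = x by apply: eq_player; rewrite // qq' xu.
      by subst q'; case/eqP: wv; apply: (mt_uniq mM q'w); rewrite mtC.
    apply: (wM v x q' cc vx1 vx cq'); rewrite ?qq' ?xu //; [by move: lt q'x; rewrite ux ltnS leq_eqVlt; case: eqP|by exists w].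
  have qu : q' != u by apply: contraTneq lt => ->; rewrite ltnn.
  have ne : q' = v -> False.
    by move=> E; move: cq; rewrite /view /= -qq' E off0.
  case: oN => [w *|x /ne|x /eqP|x /ne] //; last by rewrite (negPf qu).
  by apply: nold; exists w.
(* C1 hands its lower cover over to C0; the lower level stays as it was. *)
- subst c q.
  have qv : q' != v by apply: contraTneq lt => ->; rewrite ltnn.
  have ne : q' = u -> False.
    by move=> E; move: cq; rewrite /view /= -qq' E off0.
  case: oN => [w q'w lq' _ _ wv wu|x /eqP|x /ne|x /eqP] //; rewrite ?(negPf qv) //.
  case: orig => [[x vx m]|[c l l']]; last first.
    by have [] := staticP e l l' => -[vk uk v0 u0]; move: cc iq; rewrite ?uk ?v0.
  have [b b'] := move_back m.
  have u2 : (view v u).1 = 2.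
    have : off v.1 u.1 < 3 by exact: edg_off e.
    by move=> h; apply/eqP; case: (offP v.1 u.1) => _ _ ->; case: (offP u.1 v.1) => _ <- _; rewrite -[off _ _]/(view u v).1 cq.
  have := movesP chain_tail_check m; rewrite cc u2 /= => /andP[/eqP vx2 /eqP x1].
  apply: (wM x v q' _ _ _ cq' qq' lt); rewrite ?x1 //.
  - by rewrite b /= vx2.
  - by rewrite mtC.
  by exists w.
case: oN.
- by move=> w q'w lq' *; apply: (wM c q q' cc cq Mcq cq' qq' lt); exists w.
- move=> x E _ vx lx; subst q'; apply: (wM c q v cc cq Mcq cq' qq' lt); by exists x.
(* A token entering the swept region would have to come from [q] itself, which is taken; the jump
   from C3 to C6 ends at the top. *)
- move=> x E _ vx lx cx xu cd; subst q'.
  have [lt'|ge] := ltnP (code x.2) (code q.2).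
    by apply: (wM c q x cc cq Mcq cx _ lt'); [rewrite xu | exists v; rewrite // mtC].
  have xq : code x.2 = code q.2.
    case: cd => [e'|[x3 u6]]; first by apply/eqP; rewrite eqn_leq ge andbT e'.
    have : code q.2 < 7 by case: (lead_cross _ cq) => //; exact: mt_ed mM Mcq.
    by move: lt; rewrite u6 => lt; rewrite ltnNge lt.
  have E : x = q by apply: eq_player; rewrite // xu qq'.
  by subst x; case/eqP: cv; apply: (mt_uniq mM (v := q)); rewrite mtC.
move=> x E _ v6 _ _ _; subst q'.
have : code q.2 < 7 by case: (lead_cross _ cq) => //; exact: mt_ed mM Mcq.
by move: lt; rewrite v6 /= => lt; rewrite ltnNge lt.
Qed.

Lemma core_edge (i : 'I_K.+2) k w : k \in [:: Q0; Q2] -> edg (i, k) w -> w.1 = i.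
Proof.
move=> kq e; symmetry; apply: off_eq.
have := check1P core_level_check e.
by rewrite (_ : (i, k).2 \in _ = true).
Qed.

Lemma core_step M M' v u : coherent M -> is_matching (G := clock K) M' ->
  transition M M' v u -> core_single M'.
Proof.
move=> [mM _ _ cM] mM' [e old orig] i a b m0 m2 bq.
have a1 := core_edge (k := Q0) isT (mt_ed mM' m0).
have b1 := core_edge (k := Q2) isT (mt_ed mM' m2).
have at0 w k : view v w = (0, k) -> w = (v.1, k).
  by case: w => j l [/eqP h /= ->]; rewrite (off_eq h).
have o0 : a.1 = i -> v.1 = i -> u.1 = i -> (view v u).1 == 0 by move=> _ /= -> ->; rewrite off0.
case: (old _ _ m0) => [[v0 au]|[u0 av]|[M0 ? ? av au]];
  case: (old _ _ m2) => [[v2 bu]|[u2 bv]|[M2 nv nu bv bu]].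
- by move: v2; rewrite -v0.
- by move: bq; rewrite bv -v0.
- subst v a; case: orig => [[x vx m]|[c l l']]; first exact: (cM i x b).
  by have [] := staticP e l l' => -[].
- by move: bq; rewrite bu -u0.
- by move: u2; rewrite -u0.
- subst u a; case: orig => [[x vx m]|[c l l']]; last by have [] := staticP e l l' => -[].
  have := movesP core_check m => /implyP/(_ (o0 a1 a1 erefl))/and3P[/implyP/(_ isT)/eqP/at0 xE _ _].
  case/eqP: bv; apply: (mt_uniq mM M2).
  by move: vx; rewrite xE a1 mtC.
- subst v b; case: orig => [[x vx m]|[c l l']]; last first.
    by have [] := staticP e l l' => -[] //= _ uk; move: bq; rewrite uk.
  have := movesP core_check m => /implyP/(_ (o0 a1 erefl b1))/and3P[_ _ /implyP/(_ bq) xq].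
  exact: (cM i a x).
- subst u b; case: orig => [[x vx m]|[c l l']]; last first.
    by have [] := staticP e l l' => -[] //= vk _; move: bq; rewrite vk.
  have := movesP core_check m => /implyP/(_ (o0 a1 b1 erefl))/and3P[_ /implyP/(_ bq)/eqP/at0 xE _].
  case/eqP: av; apply: (mt_uniq mM M0).
  by move: vx; rewrite xE b1 mtC.
exact: cM M0 M2 bq.
Qed.

Lemma coherent0 : coherent (set0 : {set {set player}}).
Proof.
split; first exact: matching0.
- by move=> v w _ _ _ _ [x]; rewrite /mt inE.
- by move=> c v w _ _; rewrite /mt inE.
by move=> i a b; rewrite /mt inE.
Qed.

Lemma coherent_step M M' : coherent M -> improvement_step (G := clock K) M M' ->
  coherent M' /\ exists v u, transition M M' v u.
Proof.
move=> iM st; have [mM' [v [u t]]] := step_transition (inv_matching iM) st.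
split; last by exists v, u.
split=> //; [exact: single_step t|exact: swept_step t|exact: core_step t].
Qed.

End Invariants.

(** * The potential *)

Section Potential.

Implicit Types (f g : nat -> bool * nat).

(** Level 0 counts as even, so that the correction at level 1 is simply its half. *)
Definition half f j : nat := if j is _.+1 then (f j).2 else 0.

(* A lower bound for the number of tests passed by the token of level j since the
   birth of that of level 1.  The last test of level i was an odd one iff half f i
   is odd, and it then required the second half of level i + 1; if level i + 1 has
   left that half, it has switched once more.  Truncation at 0 makes the value at
   the birth vanish. *)
Fixpoint potential f j : nat :=
  if j is i.+1 then
    2 * (potential f i + ((f j).1 != odd (half f i))) + (f j).2 - 4
  else 2.

Lemma potentialS f j : potential f j.+1 =
  2 * (potential f j + ((f j.+1).1 != odd (half f j))) + (f j.+1).2 - 4.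
Proof. by []. Qed.

(** Level j acts on the levels below it only through its potential and the parity of its count. *)
Lemma potential_mono f g j n : j <= n -> (forall i, j < i -> f i = g i) ->
  odd (half f j) = odd (half g j) -> potential f j <= potential g j ->
  potential f n <= potential g n.
Proof.
move=> jn E o le; suff: potential f n <= potential g n /\ odd (half f n) = odd (half g n) by case.
elim: n jn => [|n IH]; first by rewrite leqn0 => /eqP j0; rewrite j0 in o le.
rewrite leq_eqVlt => /orP[/eqP jn|jn]; first by rewrite -jn.
have [le' o'] := IH jn.
by rewrite /= E // o'; split=> //; apply: leq_sub2r; rewrite leq_add2r leq_mul2l leq_add2r.
Qed.

Lemma potential_eq f g j : (forall i, i <= j -> f i = g i) -> potential f j = potential g j.
Proof.
elim: j => //= j IH E; rewrite IH => [|i ij]; last by apply: E; exact: leqW.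
by rewrite E //; case: j E {IH} => //= j E; rewrite (E j.+1).
Qed.

(** The correction grows by at most 1, which is doubled; this is paid for by the count falling from
    2 to 0. *)
Lemma potential_switch f g j n : 0 < j <= n -> (forall i, i != j -> f i = g i) ->
  f j = (~~ (g j).1, 0) -> (g j).2 = 2 -> potential f n <= potential g n.
Proof.
case: j => // j jn E fj gj; apply: (potential_mono (j := j.+1)) => //.
- by move=> i ij; apply: E; rewrite gtn_eqF.
- by rewrite /= fj gj.
have e i : i <= j -> f i = g i by move=> ij; apply: E; rewrite ltn_eqF.
have h : half f j = half g j by case: (j) e => //= i e; rewrite e.
rewrite /= fj /= gj h (potential_eq e).
by case: (g j.+1).1; case: (odd _); rewrite /=; lia.
Qed.

(** The test changes the parity at level j, and the next level is in the half required, so its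
    correction drops from 1 to 0. Doubled, this absorbs the gain of 1 at level j. Hence only a test
    on level n itself can raise the potential there. *)
Lemma potential_pass f g j n : 0 < j <= n -> (forall i, i != j -> f i = g i) ->
  f j = ((g j).1, (g j).2.+1) -> (j < n -> (f j.+1).1 = odd (f j).2) ->
  potential f n <= (potential g n).+1.
Proof.
case: j => // j jn E fj fj1.
have e i : i <= j -> f i = g i by move=> ij; apply: E; rewrite ltn_eqF.
have h : half f j = half g j by case: (j) e => //= i e; rewrite e.
have P : potential f j.+1 <= (potential g j.+1).+1.
  by rewrite /= fj /= h (potential_eq e); case: ((g j.+1).1 != _); rewrite /=; lia.
case/andP: jn => _; rewrite leq_eqVlt => /orP[/eqP<-//|jn].
apply: leqW; apply: (potential_mono (j := j.+2)) => //.
- by move=> i ij; apply: E; rewrite gtn_eqF // ltnW.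
- by rewrite /= E // eqn_leq ltnn.
have E2 : g j.+2 = f j.+2 by rewrite E // eqn_leq ltnn.
have y := fj1 jn.
rewrite (potentialS f j.+1) (potentialS g j.+1); move: P.
move: (potential f j.+1) (potential g j.+1) => p q P.
by rewrite E2 y /= fj /=; case: (odd _) => /=; lia.
Qed.

(** Above potential 0 the correction and the count contribute at most 2 + 2, which the subtracted 4
    cancels. *)
Lemma potential_zero f n : f 1 = (false, 0) -> (forall i, 0 < i <= n -> (f i).2 <= 2) ->
  0 < n -> potential f n = 0.
Proof.
move=> f1 H; elim: n H => // -[_ _ _|n IH H _]; first by rewrite /= f1.
have IH' : potential f n.+1 = 0.
  by apply: IH => // i /andP[i0 i1]; apply: H; rewrite i0 leqW.
have h := H n.+2; rewrite leqnn /= in h; move: (h isT).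
rewrite (potentialS f n.+1) IH'; case: (_ != _) => /=; lia.
Qed.

(** Each correction is 1, so a level turns p into 2(p + 1) + 2 - 4 = 2p, starting from 2 at level
    0. *)
Lemma potential_end f n : (forall i, 0 < i <= n -> f i = (true, 2)) -> potential f n = 2 ^ n.+1.
Proof.
elim: n => // n IH H.
rewrite expnS -IH => [|i /andP[i0 i1]]; last by apply: H; rewrite i0 leqW.
rewrite /= H ?leqnn //=; suff -> : odd (half f n) = false by rewrite /=; lia.
by case: (n) H => //= m H; rewrite H //= leqnSn.
Qed.

End Potential.

(** * The potential along a sequence of steps *)

Section LowerBound.

Variable K : nat.

Notation player := ('I_K.+2 * kind)%type.
Implicit Types (v u w x a b : player) (M : {set {set player}}).

Definition position M i p : Prop :=
  exists a w : player, [/\ a.1 = i :> nat, mt M a w & phase a.2 (view a w) = Some p].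

(** No such [f] exists while some level has no token on its cycle; bounds on the potential then hold
    vacuously. *)
Definition positions M f : Prop := forall i, 0 < i <= K -> position M i (f i).

Lemma phase_owns M a w p : is_matching (G := clock K) M -> mt M a w ->
  phase a.2 (view a w) = Some p ->
  [/\ cov a.2, owns M a, p.2 < 3, 2 < code a.2 & p.1 = (code a.2 < 5)].
Proof.
move=> mM aw ph; have := check1P phase_check (mt_ed mM aw); rewrite ph.
case: p ph => y h ph /and4P[/andP[c7 c2] l h3 yy]; split=> //; first by exists w.
by move: yy; case: ifP => //= _; case: (y).
Qed.

Lemma position_owns M i p : coherent M -> position M i p ->
  exists2 a : player, a.1 = i :> nat & [/\ cov a.2, owns M a, p.2 < 3, 2 < code a.2 & p.1 = (code a.2 < 5)].
Proof. by move=> [mM _ _ _] [a [w [ai aw pa]]]; exists a => //; apply: phase_owns pa. Qed.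

Lemma position_old M M' v u i p : transition M M' v u -> position M' i p ->
  [\/ exists a w : player, [/\ a.1 = i :> nat, mt M a w, phase a.2 (view a w) = Some p,
                     a != v /\ a != u & w != v /\ w != u],
     v.1 = i :> nat /\ phase v.2 (view v u) = Some p |
     u.1 = i :> nat /\ phase u.2 (view u v) = Some p].
Proof.
move=> [_ old _] [a [w [ai aw pa]]]; case: (old _ _ aw) => [[av wu]|[au wv]|[h1 h2 h3 h4 h5]].
- by subst; constructor 2.
- by subst; constructor 3.
by constructor 1; exists a, w.
Qed.

Lemma phase_asym v u p q : edg v u ->
  phase v.2 (view v u) = Some p -> phase u.2 (view u v) = Some q -> False.
Proof.
move=> e pv pu; apply: (lead_asym e).
  by have := check1P phase_check e; rewrite pv; case: (p) => y h /and4P[].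
have e' : edg u v by rewrite edg_sym.
by have := check1P phase_check e'; rewrite pu; case: (q) => y h /and4P[].
Qed.

Lemma positions_set M f j p : position M j p ->
  (forall i, 0 < i <= K -> i != j -> position M i (f i)) ->
  positions M (fun i => if i == j then p else f i).
Proof. by move=> pj H i iK /=; case: eqVneq => [->|/H] //; apply. Qed.

(** Positions after the step come from positions before it that differ on at most one level, by a
    test or by a change of half. The second alternative is a birth on level 1. *)
Lemma potential_step M M' v u f : coherent M -> coherent M' -> transition M M' v u ->
  0 < K -> positions M' f ->
  (exists2 g, positions M g & potential f K <= (potential g K).+1) \/ potential f K = 0.
Proof.
move=> iM iM' t K0 pf; have [e _ orig] := t; have [mM sM _ _] := iM.
have old i iK := position_old t (pf i iK).
have weak i p : (exists a w : player, [/\ a.1 = i :> nat, mt M a w, phase a.2 (view a w) = Some p,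
                     a != v /\ a != u & w != v /\ w != u]) -> position M i p.
  by case=> a [w [? ? ? _ _]]; exists a, w.
have unchanged : positions M f ->
    (exists2 g, positions M g & potential f K <= (potential g K).+1) \/ potential f K = 0.
  by left; exists f.
case pv: (phase v.2 (view v u)) => [p'|].
  have pu : phase u.2 (view u v) = None.
    by case pu: (phase _ _) => //; case: (phase_asym e pv pu).
  have others i : 0 < i <= K -> i != v.1 -> position M i (f i).
    by move=> iK ij; case: (old i iK) => [/weak|[vi]|[_]] //; [rewrite vi eqxx in ij|rewrite pu].
  have [jK|jK] := boolP (0 < v.1 <= K); last first.
    apply: unchanged => i iK; apply: others => //.
    by apply: contraNneq jK => <-.
  have fj : position M v.1 (f v.1) \/ f v.1 = p'.
    by case: (old _ jK) => [/weak|[_]|[_]]; [left|rewrite pv => -[]; right|rewrite pu].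
  case: fj => fj.
    by apply: unchanged => i iK; have [->|/(others i iK)] := eqVneq i v.1.
  case: orig => [[x vx m]|[c l l']]; last first.
    by have [] := staticP e l l' => -[vk _ _ _]; move: pv; rewrite vk.
  have := movesP phase_head_check m; rewrite pv; case: p' pv fj => y' h' pv fj.
  (* A birth below level 1 consumes the token of the level above, held by C0; but that level also
     has an owner among C3 to C6, against [single]. *)
  case/orP => [/and3P[/eqP v6 /eqP vx2 /eqP vu0]|].
    have p00 : (y', h') = (false, 0) by move: pv; rewrite v6 vu0 => -[<- <-].
    right; have [j1|j1] := eqVneq (v.1 : nat) 1.
      apply: potential_zero => //; first by rewrite -j1 fj.
      by move=> i /pf/(position_owns iM')[a _ []].
    have [b _] := move_back m.
    have xv : (view x v).1 = 1 by rewrite b vx2.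
    have ji : v.1 = x.1.+1 :> nat by apply/eqP; case: (offP x.1 v.1) => _ <- _; rewrite -xv.
    have iK : 0 < x.1 <= K by lia.
    have [a ai [ca oa _ ka _]] : exists2 a : player, a.1 = x.1 :> nat &
        [/\ cov a.2, owns M a, (f x.1).2 < 3, 2 < code a.2 & (f x.1).1 = (code a.2 < 5)].
      by apply: position_owns iM _; apply: others => //; rewrite ji neq_ltn leqnn.
    have x0 : x.2 = C0 by case: vx2.
    have ax : a = x.
      apply: sM => //; rewrite ?x0 ?ai //; first exact: val_inj.
      exists v; first by rewrite mtC.
      by rewrite /leads xv.
    by move: ka; rewrite ax x0.
  case px: (phase v.2 (view v x)) => [[y h]|] // h'E.
  have pg : positions M (fun i => if i == v.1 then (y, h) else f i).
    by apply: positions_set others; exists v, x.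
  left; exists (fun i => if i == v.1 :> nat then (y, h) else f i) => //.
  case/orP: h'E => [/eqP E|/and5P[/eqP yy /eqP hh /eqP x1 /eqP u1 /andP[/eqP cx /eqP cu]]].
    rewrite (@potential_eq f (fun i => if i == v.1 :> nat then (y, h) else f i)) //.
    by move=> i _; case: eqVneq => // ->; rewrite E.
  apply: (potential_pass (j := v.1)) => //.
  - by move=> i /negPf->.
  - by rewrite eqxx fj yy hh.
  (* Both tested covers of the lower level are excluded, so its token is in the other half of the
     cycle, the one given by the parity of the new count. *)
  move=> jK'; rewrite fj /=.
  have jK2 : 0 < v.1.+1 <= K by rewrite jK'.
  case: (old _ jK2) => [[a [w [ai aw pa [av au] [wv wu]]]]|[]|[_]].
  - have [ca _ _ ka ->] := phase_owns mM aw pa.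
    have lev z : (view v z).1 = 1 -> z.1 = v.1.+1 :> nat.
      by move=> /eqP /=; case: (offP v.1 z.1) => _ -> _ /eqP.
    have nu : code a.2 != code u.2.
      by apply: contra au => /eqP E; apply/eqP/eq_player => //; apply: val_inj; rewrite /= ai (lev u).
    have nx : code a.2 != code x.2.
      apply: contra wv => /eqP E; have ax : a = x by apply: eq_player => //; apply: val_inj; rewrite /= ai (lev x).
      by subst a; apply/eqP; apply: (mt_uniq mM aw); rewrite mtC.
    move: nu nx ca ka; rewrite cu cx /tested /cov.
    by case: (odd h'); case: (code a.2) => [|[|[|[|[|[|[|]]]]]]].
  - by move/eqP; rewrite ltn_eqF.
  by rewrite pu.
case pu: (phase u.2 (view u v)) => [p'|]; last first.
  by apply: unchanged => i iK; case: (old i iK) => [/weak|[_]|[_]] //; rewrite ?pv ?pu.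
have others i : 0 < i <= K -> i != u.1 -> position M i (f i).
  by move=> iK ij; case: (old i iK) => [/weak|[_]|[ui]] //; [rewrite pv|rewrite ui eqxx in ij].
have [jK|jK] := boolP (0 < u.1 <= K); last first.
  apply: unchanged => i iK; apply: others => //.
  by apply: contraNneq jK => <-.
have fj : position M u.1 (f u.1) \/ f u.1 = p'.
  by case: (old _ jK) => [/weak|[_]|[_]]; [left|rewrite pv|rewrite pu => -[]; right].
case: fj => fj.
  by apply: unchanged => i iK; have [->|/(others i iK)] := eqVneq i u.1.
case: orig => [[x vx m]|[c l l']]; last first.
  by have [] := staticP e l l' => -[_ uk _ _]; move: pu; rewrite uk.
have [b b'] := move_back m.
have := movesP phase_tail_check m; rewrite -b -b' pu; case: p' pu fj => y' h' pu fj.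
case px: (phase x.2 (view x v)) => [[y h]|] // h'E.
have xu : x.1 = u.1.
  have e' : edg u v by rewrite edg_sym.
  have := check1P phase_check e'; rewrite pu => /and4P[/andP[_ cu] lu _ _].
  have := movesP own_tail_check m; rewrite -b -b' /= in lu *; rewrite /cov cu lu.
  by case: (m) => e1 e2 _ _; rewrite -(off_view e1 e2) => /and4P[_ _ /off_eq].
have pg : positions M (fun i => if i == u.1 then (y, h) else f i).
  by apply: positions_set others; exists x, v; rewrite xu mtC.
left; exists (fun i => if i == u.1 :> nat then (y, h) else f i) => //.
case/orP: h'E => [/eqP E|/and3P[/eqP yy /eqP hh /eqP h0]].
  rewrite (@potential_eq f (fun i => if i == u.1 :> nat then (y, h) else f i)) //.
  by move=> i _; case: eqVneq => // ->; rewrite E.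
apply: leqW; apply: (potential_switch (j := u.1)) => //.
- by move=> i /negPf->.
- by rewrite eqxx fj yy h0.
by rewrite eqxx.
Qed.

End LowerBound.

(** * Stable states and the lower bound *)

Section Stability.

Variable K : nat.

Notation player := ('I_K.+2 * kind)%type.
Implicit Types (v u w x : player) (M : {set {set player}}) (i : 'I_K.+2) (a b c k l : kind).

Definition local k : bool := all (fun p => p.1 == 0) (pref k).

Lemma view_same i k k' : view (i, k) (i, k') = (0, k').
Proof. by rewrite /view off0. Qed.

Lemma local_partner M i k w : is_matching (G := clock K) M -> local k ->
  mt M (i, k) w -> w = (i, w.2) /\ (0, w.2) \in pref k.
Proof.
move=> mM /allP lk /(mt_ed mM) e; have o := lk _ e.
have E : w = (i, w.2) by case: w o {e} => j l /off_eq /= <-.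
by split=> //; move: e; rewrite /edg E view_same.
Qed.

Lemma stable_blocked M i k c b :
  locally_stable (G := clock K) M -> mt M (i, k) (i, c) ->
  ((c, b) \in level_links) || ((b, c) \in level_links) ->
  (0, b) \in pref k -> index (0, b) (pref k) < index (0, c) (pref k) -> local b ->
  exists l, [/\ (0, l) \in pref b, mt M (i, b) (i, l) &
                index (0, l) (pref b) <= index (0, k) (pref b)].
Proof.
move=> st mkc l e lt lb; have mM : is_matching (G := clock K) M by case/andP: st.
have [/existsP[x /and3P[]]|/existsPn no] := boolP [exists x, [&& (0, x) \in pref b, mt M (i, b) (i, x) &
                index (0, x) (pref b) <= index (0, k) (pref b)]]; first by exists x.
case: (@stable_accepts _ _ _ _ (@lnk_sym K) _ _ _ _ M (i, k) (i, b) st).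
- by rewrite /edg view_same.
- by move=> w /(mt_uniq mM mkc)<-; rewrite /rnk !view_same.
- move=> w bw; have [-> pw] := local_partner mM lb bw.
  rewrite /rnk !view_same ltnNge; apply: contra (no w.2) => -> /=.
  by rewrite pw; case: (local_partner mM lb bw) => <-; rewrite bw.
by right; exists (i, c) => //; rewrite /lnk off0 /= l.
Qed.

(** Without C3 the core cannot rest: each partner of Q0 is refuted by a blocking pair, using
    [core_single]; then each core partner of Q2 falls, as Q0 is free; and once Qs and Q2 are both
    unmatched they block through [Mid]. *)
Lemma stable_exit M i : coherent M -> locally_stable (G := clock K) M -> 0 < i <= K ->
  mt M (i, C3) (i, Q2).
Proof.
move=> [mM _ _ cM] st iK; rewrite mtC; apply: contraT => /negP nx.
have blk := stable_blocked st.
have uniq k c c' : mt M (i, k) (i, c) -> mt M (i, k) (i, c') -> c = c'.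
  by move=> h h'; case: (mt_uniq mM h h').
have core a b : mt M (i, Q0) (i, a) -> mt M (i, Q2) (i, b) -> b \in [:: Q1; Q3] -> False.
  by move=> h h'; apply: (cM i (i, a) (i, b)).
have flip k c : mt M (i, k) (i, c) -> mt M (i, c) (i, k) by rewrite mtC.
have Ns : ~ mt M (i, Q0) (i, Qs).
  move=> h; case: (blk i Q0 Qs Qu h) => // l [].
  by rewrite !inE /= => /eqP[->] /flip h' _; have := uniq _ _ _ h h'.
have Nu : ~ mt M (i, Q0) (i, Qu).
  move=> h; case: (blk i Q0 Qu Q1 h) => // l [].
  rewrite !inE /= => /orP[]/eqP[->] /flip h' _; last by have := uniq _ _ _ h h'.
  exact: core h h' _.
have N3 : ~ mt M (i, Q0) (i, Q3).
  move=> h; case: (blk i Q0 Q3 Q1 h) => // l [].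
  rewrite !inE /= => /orP[]/eqP[->] /flip h' _; last by have := uniq _ _ _ h h'.
  exact: core h h' _.
have N1 : ~ mt M (i, Q0) (i, Q1).
  move=> h; case: (blk i Q1 Q0 Q2 (flip _ _ h)) => // l [].
  rewrite !inE /= => /or4P[]/eqP[->] h' //.
  - by move=> _; apply: core h h' _.
  by have := uniq _ _ _ (flip _ _ h) (flip _ _ h').
have N0 l : ~ mt M (i, Q0) (i, l).
  move=> h; have [_] := local_partner mM (k := Q0) isT h.
  by rewrite !inE /= => /or4P[]/eqP[e]; rewrite e in h.
have M1 : ~ mt M (i, Q2) (i, Q1).
  move=> h; case: (blk i Q2 Q1 Q3 h) => // l [].
  rewrite !inE /= => /orP[]/eqP[->] h' _; first by apply: (N0 Q3); apply: flip.
  by have := uniq _ _ _ h (flip _ _ h').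
have M3 : ~ mt M (i, Q2) (i, Q3).
  move=> h; case: (blk i Q3 Q2 Q0 (flip _ _ h)) => // l [_ h' _].
  exact: N0 h'.
have Ms : ~ mt M (i, Q2) (i, Qs).
  move=> h; case: (blk i Qs Q2 Q0 (flip _ _ h)) => // l [_ h' _].
  exact: N0 h'.
have M2 w : ~ mt M (i, Q2) w.
  move=> h; have [E] := local_partner mM (k := Q2) isT h.
  rewrite E in h.
  by rewrite !inE /= => /or4P[]/eqP[e]; rewrite e in h.
have Sn w : ~ mt M (i, Qs) w.
  move=> h; have [E] := local_partner mM (k := Qs) isT h; rewrite E in h.
  rewrite !inE /= => /orP[]/eqP[e]; rewrite e in h; first exact: (N0 Qs (flip _ _ h)).
  exact: (M2 _ (flip _ _ h)).
case: (@stable_accepts _ _ _ _ (@lnk_sym K) _ _ _ _ M (i, Qs) (i, Q2) st).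
- by rewrite /edg view_same.
- by move=> w /Sn.
- by move=> w /M2.
left; exists (i, Mid); rewrite /lnk !off0 /= /mid_link.
by case/andP: iK => i0 ->; rewrite gtn_eqF.
Qed.

(** The number of steps bounds the potential of all positions: at the start there are none, and a
    stable end has phase (true, 2) on every level. *)
Lemma lower_bound s : 0 < K -> improvement_seq (G := clock K) s ->
  locally_stable (G := clock K) (final_state (G := clock K) s) -> 2 ^ K.+1 <= size s.
Proof.
move=> K0 is_ st.
have := @path_inv _ _ _ _ (@lnk_irr K) (@edg_sym K) (@edg_irr K) (@rnk_inj K)
  (fun M n => coherent M /\ forall f, positions M f -> potential f K <= n) _ _ s is_.
case.
- split; first exact: coherent0.
  by move=> f /(_ 1 K0)[a [w []]]; rewrite /mt inE.
- move=> M M' n [iM H] /(coherent_step iM)[iM' [v [u t]]]; split=> // f pf.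
  have [[g pg le]|->//] := potential_step iM iM' t K0 pf.
  by apply: leq_trans le _; rewrite ltnS; apply: H.
move=> iM /(_ (fun=> (true, 2))) H.
rewrite -(@potential_end (fun=> (true, 2)) K) //; apply: H => i iK.
have iK' : i < K.+2 by lia.
have := stable_exit (i := Ordinal iK') iM st iK => h.
by exists (Ordinal iK', C3), (Ordinal iK', Q2); rewrite view_same.
Qed.

End Stability.

(** * A sequence reaching a stable matching *)

(** A position is a cover with its partner; either the cover moves to a better partner, or the
    partner to a better cover. *)
Definition position_step (s t : kind * (nat * kind)) : bool :=
  let: (k, p) := s in let: (k', q) := t in
  [&& p \in pref k, q \in pref k', p.1 < 2, q.1 < 2 &
   (k == k') && (index q (pref k) < index p (pref k)) && link_rel (offc p.1 q.1) p.2 q.2 ||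
   (p == q) && (index (offinv p.1, k') (pref p.2) < index (offinv p.1, k) (pref p.2)) && link_rel 0 k k'].

Definition base : kind * (nat * kind) := (C6, (0, Ze)).
Definition crest : kind * (nat * kind) := (C3, (0, Z3)).
(** Each quarter passes one test; the first three end on the next cover, the last one at the
    crest. *)
Definition quarter1 := [:: (C6, (1, C5)); (C6, (1, C6)); (C6, (0, Z0)); (C5, (0, Z0))].
Definition quarter2 := [:: (C5, (1, C3)); (C5, (1, C4)); (C5, (0, Z1)); (C4, (0, Z1))].
Definition quarter3 := [:: (C4, (1, C5)); (C4, (1, C6)); (C4, (0, Z2)); (C3, (0, Z2))].
Definition quarter4 := [:: (C3, (1, C3)); (C3, (1, C4)); crest].
Definition wrap := [:: (C6, (0, Z3)); base].
Definition sweep := [:: (C1, (1, C0)); (C1, (1, C1)); (C1, (1, C2)); (C1, (1, C3)); (C1, (1, C4));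
   (C0, (1, C4)); (C0, (1, C5)); (C0, (1, C6))].
Definition leave := [:: (C2, (0, Z3)); (C2, (0, Zd)); (C1, (0, Zd))].

Section Reachability.

Variable K : nat.

Notation player := ('I_K.+2 * kind)%type.
Implicit Types (v u w x : player) (M : {set {set player}}) (i j n : nat) (k c : kind)
  (p q : nat * kind) (s t : kind * (nat * kind)).

Notation reachable := (@reach _ _ _ _ (@lnk_irr K) (@edg_sym K) (@edg_irr K) (@rnk_inj K)).
Notation matching M := (is_matching (G := clock K) M).

Definition pl j k : player := (inord j, k).
Definition tail j p : player := pl (if p.1 == 1 then j.+1 else j) p.2.
Definition token j s : {set player} := [set pl j s.1; tail j s.2].

Lemma pl_eq i j k c : i <= K.+1 -> j <= K.+1 -> (pl i k == pl j c) = (i == j) && (k == c).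
Proof.
by move=> iK jK; rewrite xpair_eqE -(inj_eq val_inj) /= !inordK.
Qed.

Lemma tail_view j k p : j <= K -> p.1 < 2 -> view (pl j k) (tail j p) = p.
Proof.
move=> jK; have h1 : j < K.+2 by rewrite ltnS leqW.
have h2 : j.+1 < K.+2 by rewrite !ltnS.
case: p => [[|[|]]] // l _; rewrite /view /tail /= !inordK ?off0 //.
by rewrite /off eqxx; case: eqP => //; lia.
Qed.

Lemma tail_link j p q : j <= K -> p.1 < 2 -> q.1 < 2 ->
  link_rel (offc p.1 q.1) p.2 q.2 -> lnk (tail j p) (tail j q).
Proof.
move=> jK p2 q2 h; rewrite /lnk; apply/orP; left.
have e1 : off (pl j C0).1 (tail j p).1 = p.1 := congr1 fst (tail_view C0 jK p2).
have e2 : off (pl j C0).1 (tail j q).1 = q.1 := congr1 fst (tail_view C0 jK q2).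
by rewrite (@offcE (pl j C0).1 (tail j p).1 (tail j q).1) ?e1 ?e2 // ltnW.
Qed.

Lemma tail_edge j k p : j <= K -> p.1 < 2 -> p \in pref k -> edg (pl j k) (tail j p).
Proof. by move=> jK p2 h; rewrite /edg tail_view. Qed.

Lemma token_step j M s t : j <= K -> matching M ->
  idle M (pl j s.1) -> idle M (tail j s.2) -> idle M (pl j t.1) -> idle M (tail j t.2) ->
  position_step s t -> reachable (token j s |: M) (token j t |: M).
Proof.
case: s t => k p [k' q] jK mM /= fk fp fk' fq /and5P[pk qk p2 q2 /orP[]] /andP[/andP[/eqP E lt] l].
  subst k'; apply: (step_move (@lnk_sym K)) => //; try exact: tail_edge; last by rewrite /rnk !tail_view.
  exact: tail_link.
subst q; rewrite /token /= (setUC [set pl j k]) (setUC [set pl j k']).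
have e := tail_edge jK p2 pk; have e' := tail_edge jK p2 qk.
apply: (step_move (@lnk_sym K)) => //; try by rewrite edg_sym.
  by rewrite /lnk off0 /= l.
by rewrite /rnk (view_back (edg_off e)) (view_back (edg_off e')) !tail_view.
Qed.

Definition quiet j M : Prop := forall k, idle M (pl j k).

Definition lowers (ss : seq (kind * (nat * kind))) : seq kind :=
  [seq s.2.2 | s <- ss & s.2.1 == 1].

Lemma walk j M s ss : j <= K -> matching M -> quiet j M ->
  {in lowers (s :: ss), forall c, idle M (pl j.+1 c)} -> path position_step s ss ->
  reachable (token j s |: M) (token j (last s ss) |: M).
Proof.
move=> jK mM qM; have ft t l : t \in l -> {in lowers l, forall c, idle M (pl j.+1 c)} -> idle M (tail j t.2).
  move=> tl H; rewrite /tail; case: eqP => o; last exact: qM.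
  by apply: H; apply/mapP; exists t; rewrite // mem_filter o eqxx.
elim: ss s => [|t ss IH] s H /=; first by move=> _; exact: reach_refl.
case/andP => st pt; apply: (reach_trans (M2 := token j t |: M)).
  apply: token_step => //; apply: ft H; by rewrite !inE eqxx ?orbT.
apply: IH => // c ct; apply: H.
by move: ct; rewrite /lowers /=; case: (_ == 1); case: (_ == 1) => //; rewrite !inE => ->; rewrite ?orbT.
Qed.

Lemma create j M : j <= K -> matching M -> quiet j M -> quiet j.+1 M ->
  reachable (token j (C0, (1, C6)) |: M) (token j.+1 base |: M).
Proof.
move=> jK mM qM qM'; rewrite /token /= (setUC [set pl j C0]).
have e : edg (pl j C0) (tail j (1, C6)) by exact: tail_edge.
have b := view_back (edg_off e).
have t0 : tail j (1, C6) = pl j.+1 C6 by [].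
have v0 : view (pl j.+1 C6) (tail j.+1 (0, Ze)) = (0, Ze) by rewrite /view off0.
apply: (step_move (@lnk_sym K)) => //; try exact: qM; try exact: qM'.
- by rewrite edg_sym.
- by rewrite /edg v0.
- rewrite /lnk; have := tail_view C0 jK (p := (1, Ze)) isT; rewrite /view => -[o].
  by rewrite [tail _ _]/(tail j (1, Ze)) o.
by rewrite /rnk v0 b tail_view.
Qed.

Lemma source M : matching M -> quiet 0 M -> reachable M (token 0 (C1, (0, Zd)) |: M).
Proof.
move=> mM qM; apply: (step_static (@lnk_sym K) (c := pl 0 Mid)) => //.
- exact: qM.
- exact: tail_edge.
- by rewrite /lnk off0 /= inordK.
by rewrite /lnk off0 /= inordK.
Qed.

Fixpoint stack i n M : {set {set player}} :=
  if n is m.+1 then token i base |: stack i.+1 m M else M.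

Fixpoint settle i n M : {set {set player}} :=
  if n is m.+1 then settle i.+1 m (token i (C3, (0, Q2)) |: M) else M.

Lemma stack_add (f : {set player}) i n M : stack i n (f |: M) = f |: stack i n M.
Proof. by elim: n i => //= n IH i; rewrite IH setUCA. Qed.

Definition quiet_from i M : Prop := forall j, i <= j <= K.+1 -> quiet j M.

Lemma idle_token j M s i k : i <= K.+1 -> j <= K -> s.2.1 < 2 ->
  idle (token j s |: M) (pl i k) =
  [&& (i != j) || (k != s.1), (i != if s.2.1 == 1 then j.+1 else j) || (k != s.2.2) & idle M (pl i k)].
Proof.
move=> iK jK s2; rewrite idle_add /tail !pl_eq ?negb_and //; last exact: leqW.
by case: ifP => _ //; exact: leqW.
Qed.

Lemma quiet_from_token j M s : j <= K -> s.2.1 = 0 -> quiet_from j M -> quiet_from j.+1 (token j s |: M).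
Proof.
move=> jK s0 q i iK k; have ij : i != j by lia.
rewrite idle_token ?s0 //=; last by lia.
by rewrite ij; apply: q; lia.
Qed.

Lemma matching_token j M s : j <= K -> matching M -> s.2 \in pref s.1 -> s.2.1 < 2 ->
  idle M (pl j s.1) -> idle M (tail j s.2) -> matching (token j s |: M).
Proof. by move=> *; apply: matching_add => //; apply: tail_edge. Qed.

Lemma idle_stack i n M j k : i + n <= K.+1 -> j <= K.+1 ->
  (j < i) || (i + n <= j) || (k \notin [:: C6; Ze]) ->
  idle (stack i n M) (pl j k) = idle M (pl j k).
Proof.
elim: n i => //= n IH i iK jK H; rewrite idle_token //; last by lia.
rewrite IH ?addSnnS //; last by case/orP: H => [|->]; [lia|rewrite orbT].
case: eqVneq => //= ji; subst j.
by case/orP: H => [|]; [lia|rewrite !inE negb_or => /andP[-> ->]].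
Qed.

Lemma matching_stack i n M : i + n <= K.+1 -> matching M -> quiet_from i M -> matching (stack i n M).
Proof.
elim: n i => //= n IH i iK mM q.
have q' : quiet_from i.+1 M by move=> j jK; apply: q; lia.
have h k : idle (stack i.+1 n M) (pl i k).
  by rewrite idle_stack ?addSnnS //; [apply: q; lia|lia|rewrite ltnSn].
apply: matching_token => //; [by lia| |exact: h].
by apply: IH => //; lia.
Qed.

(** Induction on the number of levels below. Before the four tests the next token is alternately
    raised to its crest, by induction, and wrapped back to its base, making two turns in all. *)
Lemma climb n i M : i + n = K -> matching M -> quiet_from i M ->
  reachable (token i base |: stack i.+1 n M) (token i crest |: stack i.+1 n M).
Proof.
elim: n i M => [|n IH] i M iK mM q; rewrite /stack -/stack.
  rewrite addn0 in iK; subst i.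
  apply: (@walk K M base (quarter1 ++ quarter2 ++ quarter3 ++ quarter4)) => //.
    by apply: q; rewrite leqnn leqW.
  by move=> c _; apply: q; rewrite leqnn leqW.
have iK' : i <= K by lia.
have iK'' : i.+1 <= K by lia.
set S := stack i.+2 n M.
have q' : quiet_from i.+1 M by move=> j jK; apply: q; lia.
have q'' : quiet_from i.+2 M by move=> j jK; apply: q; lia.
have mS : matching S by apply: matching_stack => //; lia.
have qS j k : (i <= j <= i.+1) -> idle S (pl j k).
  by move=> ij; rewrite idle_stack ?(q j) //; lia.
have mT j s : i <= j <= i.+1 -> s.2 \in pref s.1 -> s.2.1 = 0 -> matching (token j s |: S).
  move=> ij sp s0; apply: matching_token; rewrite ?s0 //; [by lia|exact: qS|].
  by rewrite /tail s0; apply: qS.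
have up s : s.2 \in pref s.1 -> s.2.1 = 0 ->
    reachable (token i s |: (token i.+1 base |: S)) (token i s |: (token i.+1 crest |: S)).
  move=> sp s0; rewrite !(setUCA [set token i s]) -stack_add.
  apply: IH; first by lia.
    apply: matching_token; rewrite ?s0 //; first by apply: q; lia.
    by rewrite /tail s0; apply: q; lia.
  exact: quiet_from_token.
have down s : s.2 \in pref s.1 -> s.2.1 = 0 ->
    reachable (token i s |: (token i.+1 crest |: S)) (token i s |: (token i.+1 base |: S)).
  move=> sp s0; rewrite !(setUCA [set token i s]).
  apply: (@walk i.+1 _ crest wrap) => //.
  - by apply: mT; rewrite ?leqnn ?leqW.
  - by move=> k; rewrite idle_token ?s0 //= ?qS ?leqnn ?leqW ?andbT; lia.
have part s ss t : t.2 \in pref t.1 -> t.2.1 = 0 -> path position_step s ss ->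
    all (fun c => (c != t.1) && (c != t.2.2)) (lowers (s :: ss)) ->
    reachable (token i s |: (token i.+1 t |: S)) (token i (last s ss) |: (token i.+1 t |: S)).
  move=> tp t0 ps H; apply: walk => //.
  - by apply: mT; rewrite ?leqnn ?leqW.
  - by move=> k; rewrite idle_token ?t0 //= ?qS ?leqnn ?leqW ?andbT //; lia.
  move=> c /(allP H)/andP[c1 c2]; rewrite idle_token ?t0 //= ?qS ?leqnn ?leqW ?c1 ?c2 ?orbT //; lia.
have r1 := up base isT erefl.
have r2 := part base quarter1 crest isT erefl isT isT.
have r3 := down (C5, (0, Z0)) isT erefl.
have r4 := part (C5, (0, Z0)) quarter2 base isT erefl isT isT.
have r5 := up (C4, (0, Z1)) isT erefl.
have r6 := part (C4, (0, Z1)) quarter3 crest isT erefl isT isT.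
have r7 := down (C3, (0, Z2)) isT erefl.
have r8 := part (C3, (0, Z2)) quarter4 base isT erefl isT isT.
exact: (reach_trans r1 (reach_trans r2 (reach_trans r3 (reach_trans r4
  (reach_trans r5 (reach_trans r6 (reach_trans r7 r8))))))).
Qed.

(** The level below is empty, so the token passes all its tests without waiting. *)
Lemma descend j M : 0 < j < K -> matching M -> quiet j M -> quiet j.+1 M ->
  reachable (token j base |: M) (token j.+1 base |: M).
Proof.
move=> jK mM q q'; apply: reach_trans (create _ _ _ _) => //; last by lia.
apply: (@walk j M base (quarter1 ++ quarter2 ++ quarter3 ++ quarter4 ++ leave ++ sweep)) => //.
by lia.
Qed.

Lemma install_token i M : 0 < i <= K -> matching M -> (forall j, j <= i -> quiet j M) ->
  reachable M (token i base |: M).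
Proof.
elim: i => // -[|i] IH iK mM q.
  apply: reach_trans (source mM (q 0 _)) _ => //.
  apply: reach_trans (create _ _ _ _) => //; try exact: q.
  by apply: (@walk 0 M (C1, (0, Zd)) sweep) => // [|c _]; exact: q.
have {}IH : reachable M (token i.+1 base |: M).
  by apply: IH => //; [lia|move=> j ij; apply: q; exact: leqW].
apply: reach_trans IH _; apply: descend => //; exact: q.
Qed.

(** Levels are filled from K up to 1, because each token descends through the levels above its own
    while they are empty. *)
Lemma install n : n <= K -> reachable set0 (stack (K - n).+1 n set0).
Proof.
have q0 j : quiet j set0 by move=> k; exact: idle_set0.
elim: n => [_|n IH nK]; first exact: reach_refl.
apply: reach_trans (IH (ltnW nK)) _.
have -> : (K - n).+1 = (K - n.+1).+2 by lia.
rewrite /= ; apply: install_token; first by lia.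
  by apply: matching_stack; [lia|exact: matching0|move=> *; exact: q0].
by move=> j jK k; rewrite idle_stack ?q0 //; lia.
Qed.

(** Tokens exit from the top level downwards: a climb leaves the lower tokens at their bases and
    does not involve the levels above. *)
Lemma settle_reach n i M : i + n = K.+1 -> matching M -> quiet_from i M ->
  reachable (stack i n M) (settle i n M).
Proof.
elim: n i M => [|n IH] i M iK mM q; first exact: reach_refl.
have iK' : i <= K by lia.
have q' : quiet_from i.+1 M by move=> j jK; apply: q; lia.
apply: (reach_trans (M2 := token i crest |: stack i.+1 n M)).
  by apply: climb => //; lia.
apply: (reach_trans (M2 := stack i.+1 n (token i (C3, (0, Q2)) |: M))).
  rewrite stack_add; apply: (@walk i _ crest [:: (C3, (0, Q2))]) => //.
    by apply: matching_stack => //; lia.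
  by move=> k; rewrite idle_stack ?(q i) //; lia.
apply: IH; first by lia.
  by apply: matching_token => //; apply: q; lia.
exact: quiet_from_token.
Qed.

Definition exits : {set {set player}} := settle 1 K set0.
(** The extra pair plugs the source: C1 of level 0 prefers C2 of level 1 to Zd, and cannot advance
    to C3, which is held by Q2. *)
Definition final : {set {set player}} := token 0 (C1, (1, C2)) |: exits.

Lemma in_settle n i M (f : {set player}) : reflect
  (f \in M \/ exists2 j, i <= j < i + n & f = token j (C3, (0, Q2))) (f \in settle i n M).
Proof.
elim: n i M => [|n IH] i M /=.
  by apply: (iffP idP) => [|[//|[j]]]; [left|lia].
apply: (iffP (IH _ _)) => [[|[j ij ->]]|[fM|[j ij ->]]].
- rewrite !inE => /orP[/eqP->|]; last by left.
  by right; exists i => //; lia.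
- by right; exists j => //; lia.
- by left; rewrite !inE fM orbT.
have [->|ji] := eqVneq j i; first by left; rewrite !inE eqxx.
by right; exists j => //; lia.
Qed.

Lemma matching_settle n i M : i + n <= K.+1 -> matching M -> quiet_from i M -> matching (settle i n M).
Proof.
elim: n i M => //= n IH i M iK mM q; apply: IH; first by lia.
  by apply: matching_token => //; [lia|apply: q; lia|apply: q; lia].
by apply: quiet_from_token => //; lia.
Qed.

Lemma idle_settle n i M v : idle M v ->
  (forall j, i <= j < i + n -> v != pl j C3 /\ v != pl j Q2) -> idle (settle i n M) v.
Proof.
elim: n i M => //= n IH i M iv H; apply: IH => [|j ij]; last by apply: H; lia.
by rewrite idle_add; have [|-> ->] := H i; first lia.
Qed.

Lemma matching_exits : matching exits.
Proof. by apply: matching_settle => //; [exact: matching0|move=> j jK k; exact: idle_set0]. Qed.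

Lemma quiet_exits : quiet 0 exits.
Proof.
move=> k; apply: idle_settle => [|j jK]; first exact: idle_set0.
by rewrite !pl_eq //; lia.
Qed.

Lemma idle_exits j k : j <= K.+1 -> k \notin [:: C3; Q2] -> idle exits (pl j k).
Proof.
move=> jK; rewrite !inE negb_or => /andP[k1 k2].
apply: idle_settle => [|i iK]; first exact: idle_set0.
by rewrite !pl_eq ?(negPf k1) ?(negPf k2) ?andbF //; lia.
Qed.

Lemma matching_final : 0 < K -> matching final.
Proof.
move=> K0; apply: matching_token => //; [exact: matching_exits|exact: quiet_exits|].
exact: idle_exits.
Qed.

Lemma reach_final : 0 < K -> reachable set0 final.
Proof.
move=> K0; have := install (leqnn K); rewrite subnn => r.
apply: (reach_trans r); apply: (reach_trans (M2 := exits)).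
  by apply: settle_reach; [|exact: matching0|move=> j jK k; exact: idle_set0].
apply: reach_trans (source matching_exits quiet_exits) _.
apply: (@walk 0 _ (C1, (0, Zd)) [:: (C1, (1, C0)); (C1, (1, C1)); (C1, (1, C2))]) => //.
- exact: matching_exits.
- exact: quiet_exits.
by move=> c; rewrite !inE => /or3P[]/eqP->; apply: idle_exits.
Qed.

Lemma mt_final v w : 0 < K -> mt final v w ->
  [\/ v = pl 0 C1 /\ w = pl 1 C2, v = pl 1 C2 /\ w = pl 0 C1 |
   exists2 j, 0 < j <= K & (v = pl j C3 /\ w = pl j Q2) \/ (v = pl j Q2 /\ w = pl j C3)].
Proof.
move=> K0; rewrite /mt in_setU1 => /orP[/eqP/set2_inj[[-> ->]|[-> ->]]|/in_settle[|[j jK]]].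
- by constructor 1.
- by constructor 2.
- by rewrite inE.
by move=> /set2_inj h; constructor 3; exists j => //; lia.
Qed.

(** Among the pairs of [final] only the plug of the source has a move, namely of C1 to C3 of level
    1, who refuses. *)
Lemma stuck_check : check_move (fun k p q =>
  [&& (k, p) != (C3, (0, Q2)), (k, p) != (Q2, (0, C3)), (k, p) != (C2, (2, C1)) &
      ((k, p) == (C1, (1, C2))) ==> (q == (1, C3))]).
Proof. by vm_compute. Qed.

Lemma final_best j w : 0 < j <= K -> (accepts (@rnk K) final (pl j C3) w -> False) /\
   (accepts (@rnk K) final (pl j Q2) w -> False).
Proof.
move=> jK; have h : mt final (pl j C3) (pl j Q2).
  by rewrite /mt in_setU1; apply/orP; right; apply/in_settle; right; exists j; rewrite // add1n.
split; first by move/(_ _ h); rewrite {2}/rnk view_same.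
by rewrite mtC in h; move/(_ _ h); rewrite {2}/rnk view_same.
Qed.

Lemma stable_final : 0 < K -> locally_stable (G := clock K) final.
Proof.
move=> K0; have mF := matching_final K0.
apply: (stableI (@lnk_sym K)) => // [|v u e av au]; first exact: edg_nolink.
have src : mt final (pl 0 C1) (pl 1 C2) by rewrite /mt in_setU1 eqxx.
have plE (x : player) : x = pl x.1 x.2 by case: x => i k; rewrite /pl inord_val.
have no_source (x y : player) : x.2 = C1 -> y.2 = Zd -> x.1 = 0 :> nat -> y.1 = 0 :> nat ->
    accepts (@rnk K) final x y -> False.
  move=> xk yk x0 y0; rewrite (plE x) (plE y) xk yk x0 y0 => /(_ _ src).
  by rewrite /rnk view_same (tail_view C1 (leq0n K) (p := (1, C2)) isT).
have no_core (x y : player) : x.2 = Q2 -> 0 < x.1 <= K -> accepts (@rnk K) final x y -> False.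
  by move=> xk x1; rewrite (plE x) xk; apply: (final_best y x1).2.
case=> [[c /andP[l l']]|[x vx l]].
  case: (staticP e l l') => -[vk uk v0 u0].
  - exact: no_source av.
  - exact: no_source au.
  - by apply: no_core au; rewrite // v0.
  - exact: no_core av.
have m : moves v x u by split=> //; [exact: mt_ed mF vx|exact: av].
have := movesP stuck_check m.
case: (mt_final K0 vx) => [[vE xE]|[vE xE]|[j jK]]; last first.
- by case=> -[vE xE]; subst v x; rewrite view_same.
- subst v x; have := view_back (edg_off (mt_ed mF src)).
  by rewrite (tail_view C1 (leq0n K) (p := (1, C2)) isT) => ->.
subst v x; rewrite (tail_view C1 (leq0n K) (p := (1, C2)) isT) /=.
move=> /eqP uE.
have uu : u = pl 1 C3.
  apply: (@view_inj K (pl 0 C1)); first exact: edg_off e.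
  by rewrite uE (tail_view C1 (leq0n K) (p := (1, C3)) isT).
by rewrite uu in au; apply: (final_best _ _).1 au.
Qed.

End Reachability.

(** * Bipartiteness and the exponential bound *)

Lemma clock_bipartite K : bipartite (clock K).
Proof.
(* The parity of the level corrects [side] for edges between consecutive levels. *)
exists [set p : 'I_K.+2 * kind | odd p.1 (+) side p.2], [set p : 'I_K.+2 * kind | ~~ (odd p.1 (+) side p.2)].
split; first by apply/setP => p; rewrite !inE orbN.
  by apply/pred0P => p; rewrite !inE andbN.
move=> e /imsetP[[v w]]; rewrite inE /= => vw ->.
have : odd v.1 (+) side v.2 = ~~ (odd w.1 (+) side w.2).
  have := check1P side_check vw; have := edg_off vw; rewrite /=.
  case: (offP v.1 w.1); case: (off v.1 w.1) => [|[|[|]]] //= /esym.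
  - by move=> /eqP-> _ _ _; case: (side v.2); case: (side w.2); case: (odd _).
  - by move=> _ /esym/eqP-> _ _ /=; case: (side v.2); case: (side w.2); case: (odd _).
  - by move=> _ _ /esym/eqP-> _ /=; case: (side v.2); case: (side w.2); case: (odd _).
case E: (odd v.1 (+) side v.2) => F.
  by exists v, w; rewrite !inE E -F.
by exists w, v; rewrite !inE E setUC; split=> //; move: F; case: (_ (+) _).
Qed.

Lemma card_player K : #|player (clock K)| = K.+2 * 20.
Proof. by rewrite card_prod card_ord card_kind. Qed.

Import Order.TTheory GRing.Theory Num.Theory.
Local Open Scope ring_scope.

Theorem theorem5 (R : realType) :
  exists c : R, 0 < c /\
    forall n : nat, exists G : network_game,
      [/\ (n <= #|player G|)%N,
          bipartite G,
          (exists s : seq {set {set player G}},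
             improvement_seq s /\ locally_stable (final_state s)) &
          (forall s : seq {set {set player G}},
             improvement_seq s -> locally_stable (final_state s) ->
             2 `^ (c * #|player G|%:R) <= (size s)%:R)].
Proof.
(* With K = n + 1 there are 20(n + 3) players, and 20(n + 3) / 40 is at most n + 2 = K + 1, the
   exponent of the lower bound. *)
exists (40%:R)^-1; split; first by rewrite invr_gt0 ltr0n.
move=> n; exists (clock n.+1); split.
- by rewrite card_player; lia.
- exact: clock_bipartite.
- have [s [ps fs]] := @reach_final n.+1 isT.
  by exists s; split=> //; rewrite /final_state fs; apply: stable_final.
move=> s is_ st; have := lower_bound (ltn0Sn n) is_ st.
rewrite -(ler_nat R) => /(le_trans _); apply.
rewrite natrX -powR_mulrn ?ler0n //; apply: ler_powR; first by rewrite ler1n.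
by rewrite card_player ler_pdivrMl ?ltr0n // -natrM ler_nat; lia.
Qed.
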